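(* A Riemannian manifold $(M,g)$ of dimension $n\ge 3$ is a $P$-space by Venzi if and only if it is of constant curvature.
   Context: $(M,g)$ is a connected smooth Riemannian manifold of dimension $n\ge 3$; $R$ is the $(0,4)$ Riemann curvature tensor, with the sign convention that the Ricci tensor $S(X_2,X_3)$ is the $g$-trace of $R(X_1,X_2,X_3,X_4)$ over $X_1,X_4$. Projective curvature tensor: $P(X_1,X_2,X_3,X_4)=R(X_1,X_2,X_3,X_4)-\frac{1}{n-1}\left[S(X_2,X_3)g(X_1,X_4)-S(X_1,X_3)g(X_2,X_4)\right]$. For a $(0,4)$-tensor $D$, let $\mathcal L(M)$ be the vector space of all 1-forms $\Theta$ on $M$ satisfying $$\Theta(X_1)D(X_2,X_3,X_4,X_5)+\Theta(X_2)D(X_3,X_1,X_4,X_5)+\Theta(X_3)D(X_1,X_2,X_4,X_5)=0$$ for all vector fields $X_1,\dots,X_5$. $M$ is called a $D$-space by Venzi if $\dim\mathcal L(M)\ge1$.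
   Formalization: The condition dim L(M) ≥ 1 is taken pointwise: at each point the values of the forms in L(M) span a space of dimension ≥ 1. Read as ''L(M) is nonzero'' the claim fails: take a metric flat only in a ball and a 1-form supported in that ball. *)

(* Defs.v *)
From HB Require Import structures.
From mathcomp Require Import all_boot all_order all_algebra.
From mathcomp Require Import all_classical all_reals all_analysis.

Set Implicit Arguments.
Unset Strict Implicit.
Unset Printing Implicit Defensive.

Import Order.TTheory GRing.Theory Num.Theory.
Import numFieldNormedType.Exports.

Local Open Scope classical_set_scope.
Local Open Scope ring_scope.

(* Tensors are represented classically, by their components in the charts of
   an atlas.  Vectors and covectors at a point are rows ['rV[R]_n] of components
   with respect to the coordinate (co)frame of a chart. *)

Definition basis_vec (R : realType) (n : nat) (i : 'I_n) : 'rV[R]_n :=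
  delta_mx 0 i.

Definition pd (R : realType) (n : nat) (i : 'I_n) (f : 'rV[R]_n -> R)
  (x : 'rV[R]_n) : R := 'D_(basis_vec R i) f x.

(* [U] is meant to be open. *)
Fixpoint Ck_on (R : realType) (n k : nat) (U : set 'rV[R]_n)
    (f : 'rV[R]_n -> R) : Prop :=
  (forall x, U x -> {for x, continuous f}) /\
  match k with
  | 0 => True
  | k'.+1 => forall i : 'I_n,
      (forall x, U x -> derivable f x (basis_vec R i)) /\ Ck_on k' U (pd i f)
  end.

Definition smooth_on (R : realType) (n : nat) (U : set 'rV[R]_n)
  (f : 'rV[R]_n -> R) : Prop := forall k, Ck_on k U f.

(* A smooth structure is given by an atlas that need not be maximal.  [chart]
   and [param] are inverse homeomorphisms between [dom i] and its image; their
   values elsewhere are irrelevant. *)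
Record smooth_atlas (R : realType) (n : nat) (M : topologicalType) := SmoothAtlas {
  chart_idx : Type;
  dom : chart_idx -> set M;
  chart : chart_idx -> M -> 'rV[R]_n;
  param : chart_idx -> 'rV[R]_n -> M;
  dom_open : forall i, open (dom i);
  dom_cover : forall p, exists i, dom i p;
  image_open : forall i, open (chart i @` dom i);
  chartK : forall i p, dom i p -> param i (chart i p) = p;
  chart_cont : forall i p, dom i p -> {for p, continuous (chart i)};
  param_cont : forall i x, (chart i @` dom i) x -> {for x, continuous (param i)};
  transition_smooth : forall i j (a : 'I_n),
    smooth_on (chart j @` (dom i `&` dom j))
      (fun y => chart i (param j y) 0 a)
}.

Section Manifold.
Variables (R : realType) (n : nat) (M : topologicalType).
Variable A : smooth_atlas R n M.

Let idx := chart_idx A.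

Definition cimage (i : idx) : set 'rV[R]_n := chart i @` dom i.

(* Entry [(a, b)] is the derivative of the [a]-th coordinate of chart [i] along
   the [b]-th coordinate of chart [j], at [p]. *)
Definition jacobian (i j : idx) (p : M) : 'M[R]_n :=
  \matrix_(a, b) pd b (fun y => chart i (param j y) 0 a) (chart j p).

Record riemannian_metric := RiemannianMetric {
  gmx : idx -> 'rV[R]_n -> 'M[R]_n;
  gmx_smooth : forall i (a b : 'I_n),
    smooth_on (cimage i) (fun x => gmx i x a b);
  gmx_sym : forall i x, cimage i x -> (gmx i x)^T = gmx i x;
  gmx_pos : forall i x, cimage i x ->
    forall u : 'rV[R]_n, u != 0 -> 0 < (u *m gmx i x *m u^T) 0 0;
  gmx_compat : forall i j p, dom i p -> dom j p ->
    gmx j (chart j p) =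
    (jacobian i j p)^T *m gmx i (chart i p) *m jacobian i j p
}.

(* A smooth 1-form, given by its component functions in each chart. *)
Definition one_form (T : idx -> 'rV[R]_n -> 'rV[R]_n) : Prop :=
  (forall i (a : 'I_n), smooth_on (cimage i) (fun x => T i x 0 a)) /\
  (forall i j p, dom i p -> dom j p ->
     T j (chart j p) = T i (chart i p) *m jacobian i j p).

(* The value of a covector on a vector. *)
Definition pairing (t v : 'rV[R]_n) : R := \sum_a t 0 a * v 0 a.

(* A (0,4)-tensor field: [D i x] is the 4-linear form, in the components of
   chart [i], at the point of coordinates [x]. *)
Definition tensor04 : Type :=
  idx -> 'rV[R]_n -> 'rV[R]_n -> 'rV[R]_n -> 'rV[R]_n -> 'rV[R]_n -> R.

Definition venzi_forms (D : tensor04) : set (idx -> 'rV[R]_n -> 'rV[R]_n) :=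
  [set T | one_form T /\
    forall i x, cimage i x -> forall X1 X2 X3 X4 X5 : 'rV[R]_n,
      pairing (T i x) X1 * D i x X2 X3 X4 X5
      + pairing (T i x) X2 * D i x X3 X1 X4 X5
      + pairing (T i x) X3 * D i x X1 X2 X4 X5 = 0].

(* [venzi_forms D] is a module over the smooth functions, so its dimension over
   the reals is 0 or infinite; moreover it may be nonzero because of forms
   supported in a region where [D] vanishes.  The dimension is therefore
   taken at each point: it is that of the space of values at [p] of the
   global forms in [venzi_forms D]. *)
Definition venzi_space (D : tensor04) : Prop :=
  forall i p, dom i p ->
    exists U : {vspace 'rV[R]_n},
      (forall t, t \in U <->
         exists2 T, venzi_forms D T & T i (chart i p) = t) /\
      (1 <= \dim U)%N.

End Manifold.

Section Curvature.
Variables (R : realType) (n : nat).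
(* The matrix of the metric in a chart. *)
Variable G : 'rV[R]_n -> 'M[R]_n.
Implicit Types (x u v : 'rV[R]_n) (i j k l m : 'I_n).

Definition inner x u v : R := (u *m G x *m v^T) 0 0.

Definition ginv x : 'M[R]_n := invmx (G x).

(* [christoffel l j k] is the Christoffel symbol with upper index [l]. *)
Definition christoffel l j k x : R :=
  2^-1 * \sum_m ginv x l m *
    (pd j (fun y => G y m k) x + pd k (fun y => G y m j) x
     - pd m (fun y => G y j k) x).

(* The [l]-th component of
   nabla_i (nabla_j d_k) - nabla_j (nabla_i d_k), where d_k is the [k]-th
   coordinate vector field. *)
Definition riem_up i j k l x : R :=
  pd i (christoffel l j k) x - pd j (christoffel l i k) x
  + \sum_m (christoffel m j k x * christoffel l i m x
            - christoffel m i k x * christoffel l j m x).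

Definition riem x (X1 X2 X3 X4 : 'rV[R]_n) : R :=
  \sum_i \sum_j \sum_k \sum_l
    X1 0 i * X2 0 j * X3 0 k * X4 0 l * \sum_m riem_up i j k m x * G x m l.

Definition ricci x (X2 X3 : 'rV[R]_n) : R :=
  \sum_a \sum_b ginv x a b * riem x (basis_vec R a) X2 X3 (basis_vec R b).

Definition projective x (X1 X2 X3 X4 : 'rV[R]_n) : R :=
  riem x X1 X2 X3 X4
  - (n.-1%:R)^-1 * (ricci x X2 X3 * inner x X1 X4
                    - ricci x X1 X3 * inner x X2 X4).

Definition sectional x u v : R :=
  riem x u v v u / (inner x u u * inner x v v - inner x u v ^+ 2).

End Curvature.

Section RiemannianManifold.
Variables (R : realType) (n : nat) (M : topologicalType).
Variables (A : smooth_atlas R n M) (g : riemannian_metric A).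

Definition projective_tensor : tensor04 A := fun i => projective (gmx g i).

Definition constant_curvature : Prop :=
  exists c : R, forall i p, dom i p -> forall u v : 'rV[R]_n,
    free [:: u; v] -> sectional (gmx g i) (chart i p) u v = c.

End RiemannianManifold.

(* Main.v *)
(* If a nonzero covector [t] satisfies the Venzi identity at a point, trace it
   over the first and last arguments with the metric: since every trace of P
   involving its fourth argument vanishes, P(.,.,.,T) = 0 for T = t^#.  The
   part of P symmetric in its last two arguments involves only S and g, and
   tracing the Venzi identity for it forces S = lambda g; then P has all the
   symmetries of a curvature tensor, so P(T,.,.,.) = 0 too, and putting X1 = T
   in the Venzi identity gives P = 0, i.e. R = K(x) (g g - g g).  Schur's lemma
   (the second Bianchi identity) makes K locally constant in each chart; K does
   not depend on the chart because curvature is natural under change of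
   coordinates, and connectedness concludes.  Conversely, constant sectional
   curvature determines R by polarization and makes P vanish, so every 1-form
   qualifies, and every covector extends to a global 1-form by means of a bump
   function. *)

From HB Require Import structures.
Require Import Defs.
From mathcomp Require Import all_boot all_order all_algebra.
From mathcomp Require Import all_classical all_reals all_analysis.
From mathcomp Require Import ring lra.

Set Implicit Arguments.
Unset Strict Implicit.
Unset Printing Implicit Defensive.

Import Order.TTheory GRing.Theory Num.Theory.
Import numFieldNormedType.Exports.

Local Open Scope classical_set_scope.
Local Open Scope ring_scope.

(** * Partial derivatives on coordinate space *)

Section PartialDerivatives.
Variables (R : realType) (n : nat).
Implicit Types (f g : 'rV[R]_n -> R) (x y : 'rV[R]_n) (i j a b : 'I_n).
Local Notation e_ i := (basis_vec R (i : 'I_n)).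

(** Tracing the symmetric part of P does not give S = lambda g at once, but S = a g + b (tau tensor
    tau) with tau dual to T. Inserting T cancels a factor n - 2 and makes T an eigenvector of S;
    then b is proportional to n S(T,T) - |T|^2 r, with r the scalar curvature, and this vanishes by
    tracing P(T,.,.,T) = 0 over the middle arguments. The bound on n returns in Schur's lemma, which
    needs three distinct indices. The algebra yields one constant for each chart and point, picked
    by choice, so nothing is known of the regularity of K. Its smoothness is recovered as a
    curvature component divided by a metric coefficient before it is differentiated. Christoffel
    symbols are gathered in one matrix omega_i per coordinate direction, and curvature is d omega +
    omega wedge omega. Symmetries, second Bianchi identity and naturality thus become identities
    between noncommuting matrices; the chain rule and the symmetry of second derivatives are the
    analytic input. *)

Lemma norm_rV_le (m : nat) (v : 'rV[R]_m) (r : R) :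
  0 <= r -> (forall a : 'I_m, `|v 0 a| <= r) -> `|v| <= r.
Proof.
move=> r0 vr; rewrite [leLHS]/Num.Def.normr/= mx_normrE.
by apply: bigmax_le => // -[k a] _ /=; rewrite (ord1 k).
Qed.

Lemma norm_coord_le (m : nat) (v : 'rV[R]_m) (a : 'I_m) : `|v 0 a| <= `|v|.
Proof.
rewrite [leRHS]/Num.Def.normr/= mx_normrE.
exact: (le_bigmax _ (fun k : 'I_1 * 'I_m => `|v k.1 k.2|) (0, a)).
Qed.

Lemma basis_vecE i a : (e_ i) 0 a = (a == i)%:R.
Proof. by rewrite mxE eqxx eq_sym. Qed.

Lemma row_sum_basis (v : 'rV[R]_n) : v = \sum_a v 0 a *: e_ a.
Proof. exact: row_sum_delta. Qed.

Lemma norm_basis_le i : `|e_ i| <= 1.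
Proof.
apply: norm_rV_le => // a; rewrite basis_vecE.
by case: eqP => _; rewrite ?normr1 ?normr0.
Qed.

Lemma derive_line (W : normedModType R) (f : 'rV[R]_n -> W) x (v : 'rV[R]_n) (t : R) :
  derivable f (x + t *: v) v ->
  is_derive t 1 (fun s => f (x + s *: v)) ('D_v f (x + t *: v)).
Proof.
have E : (fun h : R => h^-1 *: (((fun s => f (x + s *: v)) \o shift t) (h *: 1)
    - f (x + t *: v))) =
  (fun h => h^-1 *: ((f \o shift (x + t *: v)) (h *: v) - f (x + t *: v))).
  apply/funext => h /=; congr (_ *: (f _ - _)).
  by rewrite [h%:A]mulr1 scalerDl addrCA.
by move=> dfx; apply: DeriveDef; rewrite /derivable /derive E.
Qed.

Lemma derive_shiftr f x (c v : 'rV[R]_n) :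
  (derivable (fun y => f (y + c)) x v <-> derivable f (x + c) v) /\
  'D_v (fun y => f (y + c)) x = 'D_v f (x + c).
Proof.
have E : (fun h : R => h^-1 *: (((fun y => f (y + c)) \o shift x) (h *: v)
    - f (x + c))) =
  (fun h => h^-1 *: ((f \o shift (x + c)) (h *: v) - f (x + c))).
  by apply/funext => h /=; rewrite addrA.
by rewrite /derivable /derive E.
Qed.

Lemma mvt_pd f x i (s : R) :
  (forall c : R, `|c| <= `|s| -> derivable f (x + c *: e_ i) (e_ i)) ->
  exists2 c : R, `|c| <= `|s| &
    f (x + s *: e_ i) - f x = s * pd i f (x + c *: e_ i).
Proof.
move=> df; pose F t := f (x + t *: e_ i).
have F0 : F 0 = f x by rewrite /F scale0r addr0.
have dF (t : R) : `|t| <= `|s| -> is_derive t 1 F (pd i f (x + t *: e_ i)).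
  by move=> ts; exact: derive_line (df _ ts).
have [s0|s0] := leP 0 s.
- have I (t : R) : t \in `[0, s] -> `|t| <= `|s|.
    by rewrite in_itv /= => /andP[t0 ts]; rewrite !ger0_norm.
  have [||c cI Fc] := @MVT_segment R F (fun t => pd i f (x + t *: e_ i)) _ _ s0.
  + by move=> t /subset_itv_oo_cc /I /dF.
  + by apply: derivable_within_continuous => t /I /dF [].
  exists c; first exact: I.
  by rewrite -F0 -/(F s) Fc subr0 mulrC.
- have I (t : R) : t \in `[s, 0] -> `|t| <= `|s|.
    rewrite in_itv /= => /andP[ts t0].
    by rewrite !ler0_norm ?lerN2 // ltW.
  have [||c cI Fc] :=
    @MVT_segment R F (fun t => pd i f (x + t *: e_ i)) _ _ (ltW s0).
  + by move=> t /subset_itv_oo_cc /I /dF.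
  + by apply: derivable_within_continuous => t /I /dF [].
  exists c; first exact: I.
  by rewrite -F0 -/(F s) -opprB Fc sub0r mulrN opprK mulrC.
Qed.

(* The increment is split along the [n] coordinate directions, one at a time. *)
Lemma increment_pd f x (h : 'rV[R]_n) :
  (forall y, `|y - x| <= `|h| -> forall a, derivable f y (e_ a)) ->
  exists2 c : 'I_n -> 'rV[R]_n, (forall a, `|c a - x| <= `|h|) &
    f (x + h) - f x = \sum_a h 0 a * pd a f (c a).
Proof.
move=> df.
(* [p k] keeps the first [k] coordinates of [h]. In the sup norm no truncation exceeds [h], so all
   intermediate points remain where [f] is derivable. *)
pose p (k : nat) : 'rV[R]_n := \row_a (if (a < k)%N then h 0 a else 0).
have pS a : p a.+1 = p a + h 0 a *: e_ a.
  apply/rowP => b; rewrite !mxE eqxx /= ltnS leq_eqVlt -val_eqE eq_sym.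
  case: (ltngtP a b) => [ab|ba|ab]; rewrite ?mulr0 ?mulr1 ?addr0 //=.
  by rewrite add0r; congr (h 0 _); apply: val_inj.
have near_p a (c : R) : `|c| <= `|h 0 a| -> `|p a + c *: e_ a| <= `|h|.
  move=> ch; apply: norm_rV_le => // b; rewrite !mxE eqxx /= eq_sym.
  case: (eqVneq a b) => [<-|_]; rewrite /= ?mulr1 ?mulr0 ?addr0.
    by rewrite ltnn add0r (le_trans ch) // norm_coord_le.
  by case: ifP => _; rewrite ?norm_coord_le ?normr0.
have /choice [c hc] : forall a : 'I_n, exists c : R, `|c| <= `|h 0 a| /\
    f (x + p a.+1) - f (x + p a) = h 0 a * pd a f (x + p a + c *: e_ a).
  move=> a; rewrite pS addrA.
  have [c ca|c ca E] := @mvt_pd f (x + p a) a (h 0 a).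
    by apply: df; rewrite addrAC (addrAC x) subrr add0r near_p.
  by exists c.
exists (fun a => x + p a + c a *: e_ a).
  by move=> a; rewrite addrAC (addrAC x) subrr add0r near_p //; have [] := hc a.
have -> : f (x + h) - f x = f (x + p n) - f (x + p 0%N).
  congr (f (x + _) - f _); first by apply/rowP => a; rewrite mxE ltn_ord.
  by rewrite (_ : p 0%N = 0) ?addr0 //; apply/rowP => a; rewrite !mxE.
rewrite -(telescope_sumr (fun k => f (x + p k))) // big_mkord.
by apply: eq_bigr => a _; have [_ ->] := hc a.
Qed.

Definition dform f x (h : 'rV[R]_n) : R := \sum_a h 0 a * pd a f x.

Fact dform_linear f x : linear (dform f x).
Proof.
move=> k u v; rewrite /dform scaler_sumr -big_split; apply: eq_bigr => a _ /=.
by rewrite !mxE mulrDl [_ *: _]mulrA.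
Qed.

HB.instance Definition _ f x :=
  GRing.isLinear.Build R 'rV[R]_n R *:%R (dform f x) (dform_linear f x).

Lemma dform_continuous f x : continuous (dform f x).
Proof.
apply: continuous_big => [|a _ h]; first exact: add_continuous.
apply: (@continuousM _ _ _ (cst (pd a f x))).
  exact: coord_continuous.
exact: cst_continuous.
Qed.

Lemma continuous_near_le f x (e : R) : {for x, continuous f} -> 0 < e ->
  \forall y \near x, `|f y - f x| <= e.
Proof. by move=> /cvgrPdistC_le cf; exact: cf. Qed.

(** By [increment_pd] the error of the linear approximation is a sum of coordinates of the increment
    times variations of the partial derivatives near [x], which are small by continuity. *)
Lemma C1_is_diff f x :
  (\forall y \near x, forall a, derivable f y (e_ a)) ->
  (forall a, {for x, continuous (pd a f)}) -> is_diff x f (dform f x).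
Proof.
move=> df cf; set L : {linear _ -> _} := dform f x.
suff fE : f \o shift x = cst (f x) + L +o_ (0 : 'rV[R]_n) id.
  have dfL : 'd f x = L :> (_ -> _).
    by apply: diff_unique => //; exact: dform_continuous.
  apply: DiffDef => //; apply/diff_locallyP.
  by rewrite dfL; split => //; exact: dform_continuous.
apply/eqaddoP => e e0.
(* Each of the [n] coordinates costs at most [e'] times the norm of the increment; the denominator
   [n.+1] also covers [n = 0]. *)
pose e' := e / n.+1%:R; have e'0 : 0 < e' by rewrite divr_gt0.
have H : \forall y \near x, (forall a, derivable f y (e_ a)) /\
    (forall a, `|pd a f y - pd a f x| <= e').
  have H : \forall y \near x, forall a, `|pd a f y - pd a f x| <= e'.
    apply: (@filter_forall _ _ (fun a y => `|pd a f y - pd a f x| <= e')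
      (nbhs x)) => a.
    exact: continuous_near_le.
  by apply: filterS2 df H => y H1 H2.
have [r /= r0 Hr] := (nbhs_ballP _ _).1 H.
apply/nbhs_ballP; exists r => //= h; rewrite -ball_normE /= sub0r normrN => hr.
have Hy y : `|y - x| <= `|h| -> (forall a, derivable f y (e_ a)) /\
    (forall a, `|pd a f y - pd a f x| <= e').
  by move=> yx; apply: Hr; rewrite -ball_normE /= distrC (le_lt_trans yx).
have [y /Hy[]//|c cx E] := @increment_pd f x h.
rewrite !fctE /= (addrC h) opprD addrA E /L /dform /= -sumrB.
apply: (@le_trans _ _ (\sum_(a < n) `|h| * e')).
  apply: le_trans (ler_norm_sum _ _ _) _; apply: ler_sum => a _.
  rewrite -mulrBr normrM ler_pM ?norm_coord_le //.
  by have [_] := Hy _ (cx a); apply.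
rewrite sumr_const card_ord -mulr_natl mulrCA mulrC ler_wpM2r //.
rewrite /e' mulrCA ger_pMr // ler_pdivrMr ?ltr0n // mul1r ler_nat.
exact: leqnSn.
Qed.

(** The mean value theorem is applied along [i] to the increment of [f] along [j], then along [j] to
    [pd i f]. *)
Lemma second_difference f x i j (h : R) : 0 <= h ->
  (forall y, `|y - x| <= h + h -> derivable f y (e_ i)) ->
  (forall y, `|y - x| <= h + h -> derivable (pd i f) y (e_ j)) ->
  exists2 y, `|y - x| <= h + h &
    f (x + h *: e_ i + h *: e_ j) - f (x + h *: e_ i)
      - (f (x + h *: e_ j) - f x) = h * h * pd j (pd i f) y.
Proof.
move=> h0 df ddf; pose F y := f (y + h *: e_ j) - f y.
have nb (c : R) k : `|c| <= `|h| -> `|c *: e_ k| <= h.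
  rewrite normrZ (ger0_norm h0) => ch.
  by rewrite (le_trans _ ch) // ler_piMr ?norm_basis_le.
have nbb (c d : R) : `|c| <= `|h| -> `|d| <= `|h| ->
    `|x + c *: e_ i + d *: e_ j - x| <= h + h.
  move=> ch dh; rewrite addrAC (addrAC x) subrr add0r.
  by rewrite (le_trans (ler_normD _ _)) // lerD // nb.
have nb1 (c : R) : `|c| <= `|h| -> `|x + c *: e_ i - x| <= h + h.
  by move=> ch; have := nbb c 0 ch; rewrite scale0r addr0; apply; rewrite normr0.
have dF1 (c : R) : `|c| <= `|h| ->
    derivable (fun y => f (y + h *: e_ j)) (x + c *: e_ i) (e_ i).
  by move=> ch; apply/(derive_shiftr _ _ _ _).1/df/nbb.
have [c ch|c ch E1] := @mvt_pd F x i h.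
  by apply: derivableB; [exact: dF1|exact/df/nb1].
have pdF : pd i F (x + c *: e_ i) =
    pd i f (x + c *: e_ i + h *: e_ j) - pd i f (x + c *: e_ i).
  rewrite /pd /F deriveB; [|exact: dF1|exact/df/nb1].
  by rewrite (derive_shiftr f _ _ _).2.
have [d dh|d dh E2] := @mvt_pd (pd i f) (x + c *: e_ i) j h.
  exact/ddf/nbb.
exists (x + c *: e_ i + d *: e_ j); first exact: nbb.
by rewrite -/(F _) -/(F x) E1 pdF E2 mulrA.
Qed.

(** The second difference is symmetric in the two directions, so the mixed derivatives agree at two
    points near [x]; continuity of both carries the equality to [x]. *)
Lemma pd_swap f x i j :
  (\forall y \near x, derivable f y (e_ i) /\ derivable f y (e_ j)) ->
  (\forall y \near x, derivable (pd i f) y (e_ j) /\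
                      derivable (pd j f) y (e_ i)) ->
  {for x, continuous (pd j (pd i f))} -> {for x, continuous (pd i (pd j f))} ->
  pd i (pd j f) x = pd j (pd i f) x.
Proof.
move=> df ddf cij cji; apply/eqP; rewrite -subr_eq0 -normr_le0.
apply/ler_addgt0Pr => e e0; rewrite add0r.
have e20 : 0 < e / 2 by rewrite divr_gt0.
have H := filterI (filterI df ddf)
  (filterI (continuous_near_le cij e20) (continuous_near_le cji e20)).
have [r /= r0 Hr] := (nbhs_ballP _ _).1 (H _ _ _).
pose h := r / 3; have h0 : 0 < h by rewrite divr_gt0.
have {}Hr y : `|y - x| <= h + h -> ((derivable f y (e_ i) /\ derivable f y (e_ j))
   /\ (derivable (pd i f) y (e_ j) /\ derivable (pd j f) y (e_ i))) /\
   (`|pd j (pd i f) y - pd j (pd i f) x| <= e / 2 /\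
   `|pd i (pd j f) y - pd i (pd j f) x| <= e / 2).
  move=> yx; apply: Hr; rewrite -ball_normE /= distrC (le_lt_trans yx) //.
  by rewrite /h; lra.
have [y /Hr[[[]]]//|y /Hr[[_ []]]//|y yx Ey] := @second_difference f x i j h (ltW h0).
have [z /Hr[[[]]]//|z /Hr[[_ []]]//|z zx Ez] := @second_difference f x j i h (ltW h0).
have yz : pd j (pd i f) y = pd i (pd j f) z.
  apply: (mulfI (_ : h * h != 0)); first by rewrite mulf_neq0 // gt_eqF.
  apply: etrans (esym Ey) (etrans _ Ez); rewrite (addrAC x (h *: e_ j)).
  move: (f _) (f (x + h *: e_ i)) (f (x + h *: e_ j)) (f x) => p q s t.
  by rewrite !opprB addrACA [RHS]addrACA; congr (_ + _); rewrite addrC.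
have [_ [Hy _]] := Hr _ yx; have [_ [_ Hz]] := Hr _ zx.
rewrite -(subrK (pd i (pd j f) z) (pd i (pd j f) x)) -addrA -{2}yz.
rewrite (splitr e); apply: le_trans (ler_normD _ _) _.
by apply: lerD; [rewrite distrC; exact: Hz|exact: Hy].
Qed.

Lemma pd0_const_ball f x (r : R) :
  (forall y, `|y - x| < r -> forall a, derivable f y (e_ a) /\ pd a f y = 0) ->
  forall y, `|y - x| < r -> f y = f x.
Proof.
move=> df y yx; apply/eqP; rewrite -subr_eq0.
rewrite -{1}(subrK x y) (addrC (y - x)).
have [z zx a|c cx ->] := @increment_pd f x (y - x).
  by have [] := df z (le_lt_trans zx yx) a.
rewrite big1 // => a _; have [_ ->] := df _ (le_lt_trans (cx a) yx) a.
by rewrite mulr0.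
Qed.

End PartialDerivatives.

(** * Smooth functions and the chain rule *)

Section CkFunctions.
Variables (R : realType) (n : nat).
Implicit Types (f g u : 'rV[R]_n -> R) (U V : set 'rV[R]_n) (k : nat).
Local Notation e_ i := (basis_vec R (i : 'I_n)).

Lemma open_nearT U (x : 'rV[R]_n) (P : 'rV[R]_n -> Prop) :
  open U -> U x -> (forall y, U y -> P y) -> \forall y \near x, P y.
Proof. by move=> oU Ux UP; apply: filterS UP _; exact: open_nbhs_nbhs. Qed.

Lemma Ck_onW k U f : Ck_on k.+1 U f -> Ck_on k U f.
Proof.
elim: k f => [|k IH] f [cf df]; split => // i.
by have [? /IH] := df i.
Qed.

Lemma continuous_near_eq f g (x : 'rV[R]_n) : (\forall y \near x, f y = g y) ->
  {for x, continuous f} -> {for x, continuous g}.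
Proof.
move=> E; rewrite /prop_for /continuous_at -(nbhs_singleton E) => cf.
exact: cvg_trans (@near_eq_cvg _ _ (nbhs x) _ f g E) cf.
Qed.

Lemma Ck_on_eq k U f g : open U -> (forall x, U x -> f x = g x) ->
  Ck_on k U f -> Ck_on k U g.
Proof.
move=> oU; elim: k f g => [|k IH] f g fg [cf df]; split=> //;
  try by move=> x Ux; apply: continuous_near_eq (cf x Ux); exact: open_nearT Ux fg.
move=> i.
  have [dfi Cfi] := df i; split=> [x Ux|].
    by apply: near_eq_derivable (dfi x Ux); exact: open_nearT Ux fg.
  apply: IH Cfi => x Ux; apply: near_eq_derive; exact: open_nearT Ux fg.
Qed.

(** [Ck_on] is a conjunction of conditions at single points on functions defined everywhere, so any
    set around each point will do, open or not. *)
Lemma Ck_on_local k U f :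
  (forall x, U x -> exists V, V x /\ Ck_on k V f) -> Ck_on k U f.
Proof.
elim: k f => [|k IH] f Hf.
  by split=> // x /Hf [V [Vx [cf _]]]; exact: cf.
split=> [x /Hf [V [Vx [cf _]]]|i]; first exact: cf.
split=> [x /Hf [V [Vx [_ /(_ i) [df _]]]]|]; first exact: df.
by apply: IH => x /Hf [V [Vx [_ /(_ i) [_ df]]]]; exists V.
Qed.

Lemma Ck_on_sub k U V f : V `<=` U -> Ck_on k U f -> Ck_on k V f.
Proof. by move=> VU Cf; apply: Ck_on_local => x /VU Ux; exists U. Qed.

Lemma Ck_on_cst k U (c : R) : Ck_on k U (cst c).
Proof.
elim: k c => [|k IH] c; split=> //; try by move=> x _; exact: cst_continuous.
move=> i.
split=> [x _|]; first exact: derivable_cst.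
have -> : pd i (cst c) = cst 0 by apply/funext => x; exact: derive_cst.
exact: IH.
Qed.

Lemma Ck_onD k U f g : open U ->
  Ck_on k U f -> Ck_on k U g -> Ck_on k U (f + g).
Proof.
move=> oU; elim: k f g => [|k IH] f g [cf df] [cg dg].
  by split=> // x Ux; apply: continuousD; [exact: cf|exact: cg].
split=> [x Ux|i]; first by apply: continuousD; [exact: cf|exact: cg].
have [dfi Cfi] := df i; have [dgi Cgi] := dg i; split=> [x Ux|].
  by apply: derivableD; [exact: dfi|exact: dgi].
apply: Ck_on_eq oU _ (IH _ _ Cfi Cgi) => x Ux.
by rewrite /pd deriveD; [|exact: dfi|exact: dgi].
Qed.

Lemma Ck_onM k U f g : open U ->
  Ck_on k U f -> Ck_on k U g -> Ck_on k U (f * g).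
Proof.
move=> oU; elim: k f g => [|k IH] f g Cf Cg.
  by split=> // x Ux; apply: continuousM; [exact: Cf.1|exact: Cg.1].
have [[cf df] [cg dg]] := (Cf, Cg).
split=> [x Ux|i]; first by apply: continuousM; [exact: cf|exact: cg].
have [dfi Cfi] := df i; have [dgi Cgi] := dg i; split=> [x Ux|].
  by apply: derivableM; [exact: dfi|exact: dgi].
have /(Ck_on_eq oU) : forall x, U x ->
    (f * pd i g + g * pd i f) x = pd i (f * g) x.
  by move=> x Ux; rewrite /pd deriveM; [|exact: dfi|exact: dgi].
by apply; apply: Ck_onD => //; apply: IH => //; exact: Ck_onW.
Qed.

Lemma derive_comp1 (phi : R -> R) u (x v : 'rV[R]_n) (d : R) :
  is_derive (u x) 1 phi d -> derivable u x v ->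
  is_derive x v (phi \o u) (d * 'D_v u x).
Proof.
move=> [dphi phiE] du.
have du0 : derivable u (x + 0 *: v) v by rewrite scale0r addr0.
have dl := derive_line du0.
have [dl1 dl2] := dl; rewrite scale0r addr0 in dl2.
have l0 : u (x + 0 *: v) = u x by rewrite scale0r addr0.
have dphi0 := dphi; rewrite -l0 in dphi0.
have dc : derivable (phi \o (fun s : R => u (x + s *: v))) 0 1.
  apply/derivable1_diffP/differentiable_comp; first exact/derivable1_diffP.
  exact/derivable1_diffP.
have dpu : derivable (phi \o u) x v.
  apply/derivable1P; rewrite /comp.
  by under [X in derivable X]eq_fun do rewrite addrC.
have dpu0 : derivable (phi \o u) (x + 0 *: v) v by rewrite scale0r addr0.
apply: DeriveDef => //.
have [_] := derive_line dpu0; rewrite scale0r addr0 => <-.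
rewrite -derive1E (derive1_comp dl1 dphi0) !derive1E l0 phiE.
by rewrite -dl2.
Qed.

(* [D m] is the [m]-th derivative of [D 0] on [S]. *)
Lemma Ck_on_comp1 (S : set R) (D : nat -> R -> R) :
  (forall (m : nat) (t : R), S t -> is_derive t 1 (D m) (D m.+1 t)) ->
  forall k m U u, open U -> Ck_on k U u -> (forall x, U x -> S (u x)) ->
  Ck_on k U (D m \o u).
Proof.
move=> dD k m U u oU; elim: k m => [|k IH] m Cu Su.
- split=> // x Ux; apply: continuous_comp; first exact: Cu.1.
  apply/differentiable_continuous/derivable1_diffP.
  by have [] := dD m _ (Su x Ux).
have [cu du] := Cu; split=> [x Ux|i].
  apply: continuous_comp; first exact: cu.
  apply/differentiable_continuous/derivable1_diffP.
  by have [] := dD m _ (Su x Ux).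
have [dui Cui] := du i.
have H x : U x -> is_derive x (e_ i) (D m \o u) (D m.+1 (u x) * pd i u x).
  by move=> Ux; apply: derive_comp1; [exact/dD/Su|exact: dui].
split=> [x /H []//|].
have /(Ck_on_eq oU) : forall x, U x ->
    ((D m.+1 \o u) * pd i u) x = pd i (D m \o u) x.
  by move=> x /H [_ HE]; rewrite /pd HE.
by apply; apply: Ck_onM => //; apply: IH => //; exact: Ck_onW.
Qed.

End CkFunctions.

Section SmoothFunctions.
Variables (R : realType) (n : nat).
Implicit Types (f g u : 'rV[R]_n -> R) (U V : set 'rV[R]_n).
Local Notation e_ i := (basis_vec R (i : 'I_n)).

Lemma smooth_on_derivable U f x i :
  smooth_on U f -> U x -> derivable f x (e_ i).
Proof. by move=> /(_ 1%N) [_ /(_ i)[df _]]; exact: df. Qed.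

Lemma smooth_on_cont U f x : smooth_on U f -> U x -> {for x, continuous f}.
Proof. by move=> /(_ 0%N) [cf _]; exact: cf. Qed.

Lemma smooth_on_pd U f i : smooth_on U f -> smooth_on U (pd i f).
Proof. by move=> sf k; have [_ /(_ i)[]] := sf k.+1. Qed.

Lemma smooth_on_eq U f g : open U -> (forall x, U x -> f x = g x) ->
  smooth_on U f -> smooth_on U g.
Proof. by move=> oU fg sf k; exact: Ck_on_eq oU fg (sf k). Qed.

Lemma smooth_on_sub U V f : V `<=` U -> smooth_on U f -> smooth_on V f.
Proof. by move=> VU sf k; exact: Ck_on_sub VU (sf k). Qed.

Lemma smooth_on_local U f :
  (forall x, U x -> exists V, V x /\ smooth_on V f) -> smooth_on U f.
Proof.
move=> H k; apply: Ck_on_local => x /H [V [Vx sf]].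
by exists V; split => //; exact: sf.
Qed.

Lemma smooth_on_cst U (c : R) : smooth_on U (fun=> c).
Proof. by move=> k; exact: Ck_on_cst. Qed.

Lemma smooth_onD U f g : open U -> smooth_on U f -> smooth_on U g ->
  smooth_on U (fun x => f x + g x).
Proof. by move=> oU sf sg k; exact: Ck_onD (sf k) (sg k). Qed.

Lemma smooth_onM U f g : open U -> smooth_on U f -> smooth_on U g ->
  smooth_on U (fun x => f x * g x).
Proof. by move=> oU sf sg k; exact: Ck_onM (sf k) (sg k). Qed.

Lemma smooth_onN U f : open U -> smooth_on U f ->
  smooth_on U (fun x => - f x).
Proof.
move=> oU sf; have := smooth_onM oU (smooth_on_cst U (-1)) sf.
by apply: smooth_on_eq => // x _; rewrite mulN1r.
Qed.

Lemma smooth_onB U f g : open U -> smooth_on U f -> smooth_on U g ->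
  smooth_on U (fun x => f x - g x).
Proof. by move=> oU sf sg; apply: smooth_onD => //; exact: smooth_onN. Qed.

Lemma smooth_on_sum (I : Type) (r : seq I) (P : pred I)
    (F : I -> 'rV[R]_n -> R) U : open U -> (forall i, smooth_on U (F i)) ->
  smooth_on U (fun x => \sum_(i <- r | P i) F i x).
Proof.
move=> oU sF; elim: r => [|i r IH].
  by apply: (smooth_on_eq oU _ (smooth_on_cst U 0)) => x _; rewrite big_nil.
case Pi: (P i); last first.
  by apply: (smooth_on_eq oU _ IH) => x _; rewrite big_cons Pi.
by apply: (smooth_on_eq oU _ (smooth_onD oU (sF i) IH)) => x _; rewrite big_cons Pi.
Qed.

Lemma smooth_on_prod (I : Type) (r : seq I) (P : pred I)
    (F : I -> 'rV[R]_n -> R) U : open U -> (forall i, smooth_on U (F i)) ->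
  smooth_on U (fun x => \prod_(i <- r | P i) F i x).
Proof.
move=> oU sF; elim: r => [|i r IH].
  by apply: (smooth_on_eq oU _ (smooth_on_cst U 1)) => x _; rewrite big_nil.
case Pi: (P i); last first.
  by apply: (smooth_on_eq oU _ IH) => x _; rewrite big_cons Pi.
by apply: (smooth_on_eq oU _ (smooth_onM oU (sF i) IH)) => x _; rewrite big_cons Pi.
Qed.

Lemma smooth_on_comp1 (S : set R) (D : nat -> R -> R) m U u :
  (forall (l : nat) (t : R), S t -> is_derive t 1 (D l) (D l.+1 t)) -> open U ->
  smooth_on U u -> (forall x, U x -> S (u x)) ->
  smooth_on U (fun x => D m (u x)).
Proof. by move=> dD oU su Su k; exact: (Ck_on_comp1 dD). Qed.

Lemma smooth_onV U u : open U -> smooth_on U u -> (forall x, U x -> u x != 0) ->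
  smooth_on U (fun x => (u x)^-1).
Proof.
move=> oU su u0.
(* The [m]-th derivative of the inverse function. *)
pose D m (t : R) : R := (-1) ^+ m * (m`!)%:R * (t^-1) ^+ m.+1.
have dD (l : nat) (t : R) : [set t | t != 0] t -> is_derive t 1 (D l) (D l.+1 t).
  move=> /= t0.
  have dV : is_derive t 1 (fun s : R => s^-1) (- t ^- 2).
    apply: DeriveDef; first exact: derivableV.
    by rewrite deriveV // derive_id [_ *: _]mulr1.
  have := is_deriveX l.+1 dV.
  have dc := is_derive_cst ((-1) ^+ l * (l`!)%:R : R) t (1 : R).
  move=> /(is_deriveM dc) H.
  rewrite (_ : D l = cst ((-1) ^+ l * (l`!)%:R) * (fun s : R => s^-1) ^+ l.+1); last first.
    by apply/funext => s; rewrite /D exprfctE.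
  apply: is_derive_eq H _.
  rewrite scaler0 addr0 /D /cst /= ![_ *: _]mulrA factS natrM !exprS mulrN.
  rewrite expr0; move: ((-1) ^+ l) (l`!%:R) (l.+1%:R) (t^-1 ^+ l) => a b c d.
  by field.
have := smooth_on_comp1 0%N dD oU su u0.
by apply: smooth_on_eq => // x _; rewrite /D expr0 !mul1r expr1.
Qed.

Lemma smooth_on_pd_swap U f x i j : open U -> smooth_on U f -> U x ->
  pd i (pd j f) x = pd j (pd i f) x.
Proof.
move=> oU sf Ux; apply: pd_swap.
- by apply: open_nearT oU Ux _ => y Uy; split; exact: smooth_on_derivable Uy.
- by apply: open_nearT oU Ux _ => y Uy;
    split; apply: smooth_on_derivable Uy; exact: smooth_on_pd.
- by apply: smooth_on_cont Ux; do 2 apply: smooth_on_pd.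
- by apply: smooth_on_cont Ux; do 2 apply: smooth_on_pd.
Qed.

Lemma smooth_on_is_diff U f x : open U -> smooth_on U f -> U x ->
  is_diff x f (dform f x).
Proof.
move=> oU sf Ux; apply: C1_is_diff => [|a].
  by apply: open_nearT oU Ux _ => y Uy a; exact: smooth_on_derivable Uy.
by apply: smooth_on_cont Ux; exact: smooth_on_pd.
Qed.

Lemma pd_eq U f g x i : open U -> U x -> (forall y, U y -> f y = g y) ->
  pd i f x = pd i g x.
Proof. by move=> oU Ux fg; apply: near_eq_derive; exact: open_nearT Ux fg. Qed.

Lemma pdD f g x i : derivable f x (e_ i) -> derivable g x (e_ i) ->
  pd i (fun y => f y + g y) x = pd i f x + pd i g x.
Proof. exact: deriveD. Qed.

Lemma pdB f g x i : derivable f x (e_ i) -> derivable g x (e_ i) ->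
  pd i (fun y => f y - g y) x = pd i f x - pd i g x.
Proof. exact: deriveB. Qed.

Lemma pdM f g x i : derivable f x (e_ i) -> derivable g x (e_ i) ->
  pd i (fun y => f y * g y) x = pd i f x * g x + f x * pd i g x.
Proof.
move=> df dg; rewrite addrC (mulrC _ (g x)) -[RHS](deriveM df dg).
by [].
Qed.

Lemma pd_cst (c : R) x (i : 'I_n) : pd i (fun=> c) x = 0.
Proof. exact: derive_cst. Qed.

Lemma pd_sum (m : nat) (F : 'I_m -> 'rV[R]_n -> R) x i :
  (forall k, derivable (F k) x (e_ i)) ->
  pd i (fun y => \sum_k F k y) x = \sum_k pd i (F k) x.
Proof.
move=> dF; rewrite /pd -derive_sum //; congr derive.
by apply/funext => y; rewrite fct_sumE.
Qed.

Lemma derivable_sumfun (m : nat) (F : 'I_m -> 'rV[R]_n -> R) x i :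
  (forall k, derivable (F k) x (e_ i)) ->
  derivable (fun y => \sum_k F k y) x (e_ i).
Proof.
move=> dF; have -> : (fun y => \sum_k F k y) = \sum_k F k.
  by apply/funext => y; rewrite fct_sumE.
exact: derivable_sum.
Qed.

End SmoothFunctions.

Section ChainRule.
Variables (R : realType) (m n : nat).

(** Restricting to the line through [x] along the [b]-th basis vector leaves a curve in the domain
    of [f]. Since [f] is totally differentiable at [phi x], derivability of [phi] in that one
    direction is enough. *)
Lemma pd_comp (V : set 'rV[R]_n) (f : 'rV[R]_n -> R)
    (phi : 'rV[R]_m -> 'rV[R]_n) x (b : 'I_m) : open V -> smooth_on V f ->
  V (phi x) ->
  (forall a, derivable (fun y => phi y 0 a) x (basis_vec R b)) ->
  derivable (f \o phi) x (basis_vec R b) /\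
  pd b (f \o phi) x = \sum_a pd a f (phi x) * pd b (fun y => phi y 0 a) x.
Proof.
move=> oV sf Vx dphi; set v := basis_vec R b.
have dphiv : derivable phi x v.
  by apply/derivable_mxP => i a; rewrite (ord1 i).
pose gam (s : R) := phi (x + s *: v).
have gam0 : gam 0 = phi x by rewrite /gam scale0r addr0.
have x0 : x + 0 *: v = x by rewrite scale0r addr0.
have dphi0 : derivable phi (x + 0 *: v) v by rewrite x0.
have [dgam gamE] : is_derive (0 : R) (1 : R) gam ('D_v phi x).
  by have := derive_line dphi0; rewrite x0.
have sdf : is_diff (gam 0) f (dform f (phi x)).
  by rewrite gam0; exact: smooth_on_is_diff sf _.
have /derivable1_diffP dg := dgam.
have dfg : differentiable (f \o gam) 0 by apply: differentiable_comp.
have dfphi : derivable (f \o phi) x v.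
  apply/derivable1P.
  have -> : (fun s : R => (f \o phi) (s *: v + x)) = f \o gam.
    by apply/funext => s /=; rewrite /gam addrC.
  exact/derivable1_diffP.
split=> //.
have dfphi0 : derivable (f \o phi) (x + 0 *: v) v by rewrite x0.
have [_] := derive_line dfphi0; rewrite x0 /pd -/v => <-.
rewrite -[LHS]/('D_1 (f \o gam) 0) deriveE // diff_comp //= diff_val.
have -> : 'd gam 0 1 = 'D_v phi x by rewrite -gamE deriveE.
have -> := derive_mx dphiv.
by apply: eq_bigr => a _; rewrite mxE mulrC.
Qed.

End ChainRule.

Section SmoothMatrices.
Variables (R : realType) (n : nat).
Implicit Types U : set 'rV[R]_n.

Definition smooth_mx p q U (F : 'rV[R]_n -> 'M[R]_(p, q)) :=
  forall a b, smooth_on U (fun x => F x a b).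

Lemma smooth_mx_mul p q r U (F : 'rV[R]_n -> 'M[R]_(p, q))
    (G : 'rV[R]_n -> 'M[R]_(q, r)) : open U ->
  smooth_mx U F -> smooth_mx U G -> smooth_mx U (fun x => F x *m G x).
Proof.
move=> oU sF sG a b.
have : smooth_on U (fun x => \sum_j F x a j * G x j b).
  by apply: smooth_on_sum => // j; exact: smooth_onM.
by apply: smooth_on_eq => // x _; rewrite mxE.
Qed.

Lemma smooth_on_det p U (F : 'rV[R]_n -> 'M[R]_p) : open U ->
  smooth_mx U F -> smooth_on U (fun x => \det (F x)).
Proof.
move=> oU sF; apply: smooth_on_sum => // s.
apply: smooth_onM => //; first exact: smooth_on_cst.
by apply: smooth_on_prod => // i; exact: sF.
Qed.

(** Cramer's rule: the entries are cofactors divided by a nowhere vanishing determinant. *)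
Lemma smooth_mx_inv p U (F : 'rV[R]_n -> 'M[R]_p) : open U ->
  smooth_mx U F -> (forall x, U x -> F x \in unitmx) ->
  smooth_mx U (fun x => invmx (F x)).
Proof.
move=> oU sF uF a b.
have : smooth_on U (fun x => (\det (F x))^-1 * cofactor (F x) b a).
  apply: smooth_onM => //.
    apply: smooth_onV => //; first exact: smooth_on_det.
    by move=> x /uF; rewrite unitmxE unitfE.
  apply: smooth_onM => //; first exact: smooth_on_cst.
  apply: smooth_on_det => // c d.
  by apply: smooth_on_eq (sF (lift b c) (lift a d)) => // x _; rewrite !mxE.
apply: smooth_on_eq => // x Ux.
by rewrite /invmx uF // !mxE.
Qed.

End SmoothMatrices.

(** * Algebraic curvature tensors *)

Section CurvatureTensors.
Variables (R : realType) (n : nat).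
Local Notation V := 'rV[R]_n.
Implicit Types (X Y Z W u v w : V) (D : V -> V -> V -> V -> R).

Definition lin1 (f : V -> R) := forall a u v, f (a *: u + v) = a * f u + f v.

Definition multilinear4 D :=
  [/\ forall Y Z W, lin1 (fun X => D X Y Z W),
      forall X Z W, lin1 (fun Y => D X Y Z W),
      forall X Y W, lin1 (fun Z => D X Y Z W) &
      forall X Y Z, lin1 (fun W => D X Y Z W)].

Record curvature_like D : Prop := CurvatureLike {
  curv_lin : multilinear4 D;
  curv_alt12 : forall X Y Z W, D X Y Z W = - D Y X Z W;
  curv_alt34 : forall X Y Z W, D X Y Z W = - D X Y W Z;
  curv_bianchi : forall X Y Z W, D X Y Z W + D Y Z X W + D Z X Y W = 0 }.

Lemma lin1D f : lin1 f -> {morph f : u v / u + v}.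
Proof. by move=> lf u v; rewrite -{1}(scale1r u) lf mul1r. Qed.

Lemma lin10 f : lin1 f -> f 0 = 0.
Proof.
by move=> lf; have := lf (-1) 0 0; rewrite scaler0 addr0 mulN1r addNr.
Qed.

Lemma lin1Z f a u : lin1 f -> f (a *: u) = a * f u.
Proof. by move=> lf; rewrite -(addr0 (a *: u)) lf lin10 // addr0. Qed.

Lemma lin1_sum f u : lin1 f -> f u = \sum_a u 0 a * f (basis_vec R a).
Proof.
move=> lf; rewrite {1}(row_sum_basis u).
rewrite (big_morph f (lin1D lf) (lin10 lf)).
by apply: eq_bigr => a _; rewrite lin1Z.
Qed.

Lemma curv_pair D : curvature_like D ->
  forall X Y Z W, D X Y Z W = D Z W X Y.
Proof.
move=> [_ a12 a34 b] X Y Z W.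
(* The four Bianchi identities, each leaving a different argument out of the cycle; modulo the skew
   symmetries the pair symmetry is a linear combination of them. *)
have := b X Y Z W; have := b Y Z W X; have := b Z W X Y; have := b W X Y Z.
have := a12 X Y Z W; have := a34 X Y Z W; have := a34 Y X Z W.
have := a12 X Z Y W; have := a34 X Z Y W; have := a34 Z X Y W.
have := a12 X W Y Z; have := a34 X W Y Z; have := a34 W X Y Z.
have := a12 Y Z X W; have := a34 Y Z X W; have := a34 Z Y X W.
have := a12 Y W X Z; have := a34 Y W X Z; have := a34 W Y X Z.
have := a12 Z W X Y; have := a34 Z W X Y; have := a34 W Z X Y.
lra.
Qed.

(** Polarizing in [u] and then in [v] makes [D] skew in its two middle arguments, hence in any two
    of the first three. The Bianchi sum is then three times [D]. *)
Lemma curv_eq0 D : curvature_like D -> (forall u v, D u v v u = 0) ->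
  forall X Y Z W, D X Y Z W = 0.
Proof.
move=> cD D0; have pD := curv_pair cD; have [[l1 l2 l3 l4] a12 a34 b] := cD.
have D1 u v w : D u v v w = 0.
  have := D0 (u + w) v; rewrite (lin1D (l1 _ _ _)) !(lin1D (l4 _ _ _)) !D0.
  rewrite (pD w v v u) (a12 v u w v) (a34 u v w v) opprK; lra.
have a23 u v z w : D u v z w = - D u z v w.
  have := D1 u (v + z) w; rewrite (lin1D (l2 _ _ _)) !(lin1D (l3 _ _ _)) !D1.
  lra.
move=> X Y Z W; have := b X Y Z W.
rewrite (a23 Y Z X W) (a12 Y X Z W) (a12 Z X Y W) (a23 X Z Y W) !opprK; lra.
Qed.

(** * Metric traces, Ricci and projective parts for a single inner product *)

Section InnerProduct.
Variable G : 'M[R]_n.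
Hypothesis Gsym : G^T = G.
Hypothesis Gpos : forall u, u != 0 -> 0 < (u *m G *m u^T) 0 0.

Definition ip u v : R := (u *m G *m v^T) 0 0.

Lemma posdef_unit : G \in unitmx.
Proof.
rewrite -row_free_unit -kermx_eq0; apply/eqP/row_matrixP => i.
rewrite row0; apply/eqP/negP => /negP /Gpos.
by rewrite -row_mul mulmx_ker row0 mul0mx mxE ltxx.
Qed.

Lemma ipC u v : ip u v = ip v u.
Proof.
rewrite /ip -[LHS](@mxE _ 1 1 tt (fun i j => (u *m G *m v^T) j i)).
have -> : (\matrix[tt]_(i, j) (u *m G *m v^T) j i) = (u *m G *m v^T)^T.
  by apply/matrixP => i j; rewrite !mxE.
by rewrite !trmx_mul trmxK Gsym mulmxA.
Qed.

Lemma ip_linl v : lin1 (fun u => ip u v).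
Proof. by move=> a u w; rewrite /ip !mulmxDl -!scalemxAl !mxE. Qed.

Lemma ip_linr u : lin1 (ip u).
Proof. by move=> a v w; rewrite ![ip u _]ipC ip_linl. Qed.

Lemma ip_basis_l a v : ip (basis_vec R a) v = (G *m v^T) a 0.
Proof. by rewrite /ip -mulmxA -rowE mxE. Qed.

Definition mtrace (B : V -> V -> R) : R :=
  \sum_a \sum_b invmx G a b * B (basis_vec R a) (basis_vec R b).

Lemma eq_mtrace B B' : (forall X W, B X W = B' X W) -> mtrace B = mtrace B'.
Proof. by move=> E; do 2 apply: eq_bigr => ? _; rewrite E. Qed.

Lemma mtraceD B B' :
  mtrace (fun X W => B X W + B' X W) = mtrace B + mtrace B'.
Proof.
rewrite -big_split; apply: eq_bigr => a _; rewrite -big_split.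
by apply: eq_bigr => b _; rewrite mulrDr.
Qed.

Lemma mtraceZ c B : mtrace (fun X W => c * B X W) = c * mtrace B.
Proof.
rewrite mulr_sumr; apply: eq_bigr => a _; rewrite mulr_sumr.
by apply: eq_bigr => b _; rewrite mulrCA.
Qed.

Lemma mtraceN B : mtrace (fun X W => - B X W) = - mtrace B.
Proof. by rewrite -mulN1r -mtraceZ; apply: eq_mtrace => X W; rewrite mulN1r. Qed.

Lemma mtraceB B B' :
  mtrace (fun X W => B X W - B' X W) = mtrace B - mtrace B'.
Proof. by rewrite mtraceD mtraceN. Qed.

Lemma invmx_sym : (invmx G)^T = invmx G.
Proof. by rewrite trmx_inv Gsym. Qed.

Lemma mtrace_swap B : mtrace (fun X W => B W X) = mtrace B.
Proof.
rewrite /mtrace exchange_big; do 2 apply: eq_bigr => ? _.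
by rewrite -{1}invmx_sym mxE.
Qed.

(** Contracting with the inverse of [G] undoes the lowering of [Y] by [ip]. All the traces below are
    computed with this rule and [mtrace_ip]. *)
Lemma mtrace_ipl f Y : lin1 f -> mtrace (fun X W => ip X Y * f W) = f Y.
Proof.
move=> lf; rewrite /mtrace exchange_big (lin1_sum _ lf).
apply: eq_bigr => b _.
under eq_bigr => a _ do
  rewrite mulrA ip_basis_l -{1}invmx_sym (mxE _ (fun i j => invmx G j i)).
rewrite -mulr_suml; congr (_ * _).
transitivity ((invmx G *m (G *m Y^T)) b 0); first by rewrite [RHS]mxE.
by rewrite mulmxA mulVmx ?posdef_unit // mul1mx mxE.
Qed.

Lemma mtrace_ipr f Y : lin1 f -> mtrace (fun X W => f X * ip W Y) = f Y.
Proof.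
move=> lf; rewrite -mtrace_swap -[RHS](mtrace_ipl Y lf).
by apply: eq_mtrace => X W; rewrite mulrC.
Qed.

Lemma mtrace_ip : mtrace ip = n%:R.
Proof.
rewrite /mtrace.
transitivity (\sum_(a < n) (1 : R)); last by rewrite sumr_const card_ord.
apply: eq_bigr => a _.
transitivity ((invmx G *m G) a a); last first.
  by rewrite mulVmx ?posdef_unit // mxE eqxx.
rewrite [RHS]mxE; apply: eq_bigr => b _; congr (_ * _).
by rewrite ipC ip_basis_l trmx_delta -colE mxE.
Qed.

Definition ric D Y Z : R := mtrace (fun X W => D X Y Z W).

(** A copy of [projective] for one matrix [G], convertible to it when [G] is the metric at a point,
    so the algebra below applies to the tensor as it stands. *)
Definition proj_part D X Y Z W : R :=
  D X Y Z W - (n.-1%:R)^-1 * (ric D Y Z * ip X W - ric D X Z * ip Y W).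

Lemma ric_linl D Z : multilinear4 D -> lin1 (fun Y => ric D Y Z).
Proof.
move=> [_ l2 _ _] a u v; rewrite /ric -mtraceZ -mtraceD.
by apply: eq_mtrace => X W; rewrite l2.
Qed.

Lemma ricC D : curvature_like D -> forall Y Z, ric D Y Z = ric D Z Y.
Proof.
move=> cD Y Z; rewrite /ric -mtrace_swap; apply: eq_mtrace => X W.
by rewrite (curv_pair cD) (curv_alt12 cD) (curv_alt34 cD) opprK.
Qed.

Lemma ric_const D c : (0 < n)%N ->
  (forall X Y Z W, D X Y Z W = c * (ip Y Z * ip X W - ip X Z * ip Y W)) ->
  forall Y Z, ric D Y Z = c * n.-1%:R * ip Y Z.
Proof.
move=> n0 DE Y Z; rewrite /ric (eq_mtrace (fun X W => DE X Y Z W)) mtraceZ mtraceB mtraceZ.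
rewrite mtrace_ip (eq_mtrace (fun X W => congr1 (fun z => ip X Z * z) (ipC Y W))).
rewrite mtrace_ipr; last exact: ip_linl.
by rewrite -{1}(prednK n0) -natr1; ring.
Qed.

Lemma proj_part_const D c : (1 < n)%N ->
  (forall X Y Z W, D X Y Z W = c * (ip Y Z * ip X W - ip X Z * ip Y W)) ->
  forall X Y Z W, proj_part D X Y Z W = 0.
Proof.
move=> n1 DE X Y Z W; rewrite /proj_part !(ric_const (ltnW n1) DE) DE.
have : n.-1%:R != 0 :> R by rewrite pnatr_eq0 -lt0n -ltnS (ltn_predK n1).
by move=> k0; field.
Qed.

Lemma curvature_like_ip c :
  curvature_like (fun X Y Z W => c * (ip Y Z * ip X W - ip X Z * ip Y W)).
Proof.
split; [split| | |] => [Y Z W a u v|X Z W a u v|X Y W a u v|X Y Z a u v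
  |X Y Z W|X Y Z W|X Y Z W]; rewrite ?ip_linl ?ip_linr; try by ring.
by rewrite (ipC Z X) (ipC Y X) (ipC Z Y); ring.
Qed.

Lemma curvature_like_sub D D' : curvature_like D -> curvature_like D' ->
  curvature_like (fun X Y Z W => D X Y Z W - D' X Y Z W).
Proof.
move=> [[l1 l2 l3 l4] a12 a34 b] [[l1' l2' l3' l4'] a12' a34' b'].
split; [split| | |] => [Y Z W a u v|X Z W a u v|X Y W a u v|X Y Z a u v
  |X Y Z W|X Y Z W|X Y Z W].
- by rewrite l1 l1'; ring.
- by rewrite l2 l2'; ring.
- by rewrite l3 l3'; ring.
- by rewrite l4 l4'; ring.
- by rewrite a12 a12'; ring.
- by rewrite a34 a34'; ring.
- by have := b X Y Z W; have := b' X Y Z W; lra.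
Qed.

Lemma gram_gt0 u v : free [:: u; v] -> 0 < ip u u * ip v v - ip u v ^+ 2.
Proof.
rewrite free_cons seq1_free => /andP[uv v0].
have vv : 0 < ip v v by exact: Gpos.
(* A multiple of the component of [u] orthogonal to [v]; its squared length is [ip v v] times the
   Gram determinant. *)
pose w := ip v v *: u - ip u v *: v.
have w0 : w != 0.
  apply: contra uv; rewrite subr_eq0 => /eqP E.
  rewrite span_seq1; apply/vlineP; exists ((ip v v)^-1 * ip u v).
  by rewrite -scalerA -E scalerA mulVf ?scale1r // gt_eqF.
have : 0 < ip w w by exact: Gpos.
have -> : ip w w = ip v v * (ip u u * ip v v - ip u v ^+ 2).
  rewrite /w -scaleNr !(ip_linl, ip_linr) !(lin1Z _ _ (ip_linl _)).
  by rewrite !(lin1Z _ _ (ip_linr _)) (ipC v u); ring.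
by rewrite pmulr_rgt0.
Qed.

(** The difference from the model of curvature [c] is again curvature-like, so [curv_eq0] applies
    once it vanishes on [u], [v], [v], [u]. The hypothesis gives this for free pairs only; for
    dependent pairs both terms vanish by skewness. *)
Lemma sectional_const_curv D c : curvature_like D ->
  (forall u v, free [:: u; v] ->
     D u v v u / (ip u u * ip v v - ip u v ^+ 2) = c) ->
  forall X Y Z W, D X Y Z W = c * (ip Y Z * ip X W - ip X Z * ip Y W).
Proof.
move=> cD Dc X Y Z W; apply/eqP; rewrite -subr_eq0; apply/eqP.
move: X Y Z W; apply: (curv_eq0 (curvature_like_sub cD (curvature_like_ip c))).
move=> u v; have [[l1 l2 l3 l4] a12 a34 _] := cD.
case: (boolP (free [:: u; v])) => [uv|].
  rewrite -{1}(Dc _ _ uv) (ipC v u) -expr2 (mulrC (ip v v)) divfK ?subrr //.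
  by rewrite gt_eqF // gram_gt0.
have alt0 x y z : D x x y z = 0 by have := a12 x x y z; lra.
have alt0' x y z : D y z x x = 0 by have := a34 y z x x; lra.
rewrite free_cons seq1_free negb_and !negbK => /orP[|/eqP ->].
  rewrite span_seq1 => /vlineP[k ->].
  rewrite (lin1Z _ _ (l1 _ _ _)) alt0 !(lin1Z _ _ (ip_linl _)).
  by rewrite !(lin1Z _ _ (ip_linr _)); ring.
by rewrite (lin10 (l2 _ _ _)) !(lin10 (ip_linl _)) !(lin10 (ip_linr _)); ring.
Qed.

(** * The Venzi identity at a single point *)

Section Venzi.
Variables (D : V -> V -> V -> V -> R) (T : V).
Hypothesis n3 : (3 <= n)%N.
Hypothesis cD : curvature_like D.
Hypothesis T0 : T != 0.
Local Notation P := (proj_part D).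
Local Notation S := (ric D).
Local Notation tau X := (ip X T).
Local Notation sig Z := (ric D T Z).
Hypothesis venziP : forall X1 X2 X3 X4 X5,
  tau X1 * P X2 X3 X4 X5 + tau X2 * P X3 X1 X4 X5 + tau X3 * P X1 X2 X4 X5 = 0.

Let k : R := (n.-1%:R)^-1.
Let N := ip T T.
Let r := mtrace S.
Let s := sig T.

Let lD := curv_lin cD.
Let Slinl Z : lin1 (fun Y => S Y Z). Proof. exact: ric_linl. Qed.
Let SC Y Z : S Y Z = S Z Y. Proof. exact: ricC. Qed.
Let Slinr Y : lin1 (S Y).
Proof. by move=> a u v; rewrite ![S Y _]SC Slinl. Qed.

Let kE : n.-1%:R = n%:R - 1 :> R.
Proof. by rewrite -[in RHS](prednK (leq_trans _ n3)) // -natr1 addrK. Qed.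

Let n1 : n%:R - 1 != 0 :> R.
Proof. by rewrite subr_eq0 pnatr_eq1; case: (n) n3 => [|[|?]]. Qed.

Let n2 : n%:R - 2 != 0 :> R.
Proof. by rewrite subr_eq0 eqr_nat; case: (n) n3 => [|[|[|?]]]. Qed.

Let N0 : N != 0. Proof. by rewrite gt_eqF //; exact: Gpos. Qed.

Let P12 X Y Z W : P X Y Z W = - P Y X Z W.
Proof. by rewrite /proj_part (curv_alt12 cD); ring. Qed.

(** The coefficient of the projective tensor is made for this: [ip] has trace n, so the bracket has
    trace (n - 1) S. *)
Let trP Y Z : mtrace (fun X W => P X Y Z W) = 0.
Proof.
rewrite /proj_part mtraceB mtraceZ mtraceB mtraceZ mtrace_ip -/(S Y Z).
rewrite (eq_mtrace (fun X W => congr1 (fun z => S X Z * z) (ipC Y W))).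
by rewrite (mtrace_ipr _ (Slinl Z)) kE; field.
Qed.

Let Plin4 X Y Z : lin1 (P X Y Z).
Proof.
move=> a u v; have [_ _ _ l4] := lD.
by rewrite /proj_part l4 !ip_linr; ring.
Qed.

Let PT X Y Z : P X Y Z T = 0.
Proof.
rewrite -(mtrace_ipl T (Plin4 X Y Z)).
rewrite (eq_mtrace (B' := fun X1 X5 =>
  tau X * P X1 Y Z X5 - tau Y * P X1 X Z X5)).
  by rewrite mtraceB !mtraceZ !trP !mulr0 subrr.
by move=> X1 X5; have := venziP X1 X Y Z X5; rewrite (P12 Y X1); lra.
Qed.

Let PN X Y Z W : N * P X Y Z W = tau X * P T Y Z W - tau Y * P T X Z W.
Proof. by have := venziP T X Y Z W; rewrite (P12 Y T) /N; lra. Qed.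

Let Q X Y Z W : R :=
  S Y Z * ip X W - S X Z * ip Y W + S Y W * ip X Z - S X W * ip Y Z.

Let PQ X Y Z W : P X Y Z W + P X Y W Z = - k * Q X Y Z W.
Proof. by rewrite /proj_part (curv_alt34 cD X Y W Z) /Q -/k; ring. Qed.

Let QN X Y Z W : N * Q X Y Z W = tau X * Q T Y Z W - tau Y * Q T X Z W.
Proof.
have k0 : - k != 0 by rewrite oppr_eq0 invr_eq0 kE.
apply: (mulfI k0); rewrite mulrCA -PQ mulrDr !PN.
transitivity (tau X * (- k * Q T Y Z W) - tau Y * (- k * Q T X Z W)).
  by rewrite -!PQ; ring.
by ring.
Qed.

(** The trace of [QN] over [X] and [W]. Its first term contracts to [Q T Y Z T]; in the second,
    skewness of [Q] in its first two arguments brings back the trace of [Q] with [T] in second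
    place. *)
Let ricci_trace Y Z : N * (n%:R * S Y Z - r * ip Y Z) =
  N * S Y Z - sig Z * tau Y + sig Y * tau Z - s * ip Y Z
  + tau Y * (n%:R * sig Z - r * tau Z).
Proof.
have trQ U1 U2 : mtrace (fun X W => Q X U1 U2 W) = n%:R * S U1 U2 - r * ip U1 U2.
  rewrite /Q mtraceB mtraceD mtraceB mtraceZ mtrace_ip.
  rewrite (eq_mtrace (fun X W => congr1 (fun z => S X U2 * z) (ipC U1 W))).
  rewrite (mtrace_ipr _ (Slinl U2)).
  rewrite (eq_mtrace (fun X W => mulrC (S U1 W) _)) (mtrace_ipl _ (Slinr U1)).
  rewrite (eq_mtrace (fun X W => mulrC (S X W) _)) mtraceZ -/r; ring.
have Qlin U1 U2 : lin1 (fun W => Q T U1 U2 W).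
  by move=> a u v; rewrite /Q !ip_linr !Slinr; ring.
rewrite -trQ -mtraceZ (eq_mtrace (fun X W => QN X Y Z W)) mtraceB mtraceZ.
rewrite (mtrace_ipl T (Qlin Y Z)).
have -> : mtrace (fun X W => Q T X Z W) = - mtrace (fun X W => Q X T Z W).
  by rewrite -mtraceN; apply: eq_mtrace => X W; rewrite /Q; ring.
rewrite trQ /Q -/N -/s (SC Y T) (ipC T Z); ring.
Qed.

(** Taking [Z = T] in [ricci_trace] leaves a common factor n - 2, nonzero because n is at least 3.
    So [T] is an eigenvector of the Ricci tensor, with eigenvalue [s / N]. *)
Let sigE Y : N * sig Y = s * tau Y.
Proof.
have := ricci_trace Y T; rewrite (SC Y T) -/s -/N => E.
by apply: (mulfI n2); move: E; lra.
Qed.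

(** [PT] expresses D(T,Y,Z,T) through S and tau, and the trace of D(T,Y,Z,T) over [Y] and [Z] is
    S(T,T) = [s] again. *)
Let scal_eq : n%:R * s = N * r.
Proof.
have DT Y Z : D T Y Z T = k * (N * S Y Z - sig Z * tau Y).
  have := PT T Y Z; rewrite /proj_part -/k -/N => /eqP; rewrite subr_eq0 => /eqP ->.
  by ring.
have : s = k * (N * r - s).
  rewrite /s -[LHS]/(mtrace (fun X W => D X T T W)).
  rewrite (eq_mtrace (B' := fun X W => k * (N * S X W - tau X * sig W))).
    by rewrite mtraceZ mtraceB mtraceZ (mtrace_ipl _ (Slinr T)).
  move=> X W; rewrite (curv_alt12 cD) (curv_alt34 cD) opprK DT.
  by rewrite (mulrC (tau X)).
by rewrite /k kE => /(congr1 (fun z => (n%:R - 1) * z)); rewrite mulVKf //; lra.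
Qed.

(** Once [sigE] is substituted, the terms in [tau Y * tau Z] add up to a multiple of n s - N r,
    which [scal_eq] cancels; only the multiple of [ip] survives. *)
Let ricE Y Z : S Y Z = s / N * ip Y Z.
Proof.
have := ricci_trace Y Z => /(congr1 (fun z => N * z)).
move=> E; have {}E : N * N * (n%:R - 1) * S Y Z = N * (N * r - s) * ip Y Z
    - (N * sig Z) * tau Y + (N * sig Y) * tau Z
    + n%:R * (N * sig Z) * tau Y - N * r * tau Y * tau Z.
  by move: E; lra.
rewrite !sigE -scal_eq in E.
apply: (mulfI (_ : N * N * (n%:R - 1) != 0)).
  by rewrite !mulf_neq0.
by rewrite E; field.
Qed.

Lemma venzi_curvature : exists c, forall X Y Z W,
  D X Y Z W = c * (ip Y Z * ip X W - ip X Z * ip Y W).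
Proof.
(* When the Ricci tensor is lambda g, [P] is [D] minus the model of curvature lambda / (n - 1); here
   lambda is [s / N]. *)
exists (k * (s / N)).
have cP := curvature_like_sub cD (curvature_like_ip (k * (s / N))).
have PE X Y Z W : P X Y Z W =
    D X Y Z W - k * (s / N) * (ip Y Z * ip X W - ip X Z * ip Y W).
  by rewrite /proj_part !ricE -/k; ring.
have PT1 X Y Z : P T X Y Z = 0.
  have := curv_pair cP T X Y Z; rewrite /= -!PE => ->.
  by rewrite PE (curv_alt34 cP) -PE PT oppr0.
move=> X Y Z W; apply/eqP; rewrite -subr_eq0 -PE.
by rewrite -(mulrI_eq0 _ (mulfI N0)) PN !PT1 !mulr0 subrr.
Qed.

End Venzi.
End InnerProduct.
End CurvatureTensors.

(** * Matrix-valued functions *)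

Section MatrixEntries.
Variable K : pzRingType.

(* Read entrywise, an identity between sums of matrix products becomes linear
   in the entries of the products, which [ring] takes as atoms. *)
Lemma entD p q (A B : 'M[K]_(p, q)) a b : (A + B) a b = A a b + B a b.
Proof. by rewrite mxE. Qed.

Lemma entN p q (A : 'M[K]_(p, q)) a b : (- A) a b = - A a b.
Proof. by rewrite mxE. Qed.

Lemma entZ p q c (A : 'M[K]_(p, q)) a b : (c *: A) a b = c * A a b.
Proof. by rewrite mxE. Qed.

Lemma entM p q r (A : 'M[K]_(p, q)) (B : 'M[K]_(q, r)) a b :
  (A *m B) a b = \sum_j A a j * B j b.
Proof. by rewrite mxE. Qed.

Lemma entT p q (A : 'M[K]_(p, q)) a b : A^T a b = A b a.
Proof. by rewrite mxE. Qed.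

End MatrixEntries.

(* Locked, lest unification unfold derivatives down to limits. *)
HB.lock Definition mpd (R : realType) (n p q : nat) (i : 'I_n)
    (F : 'rV[R]_n -> 'M[R]_(p, q)) (x : 'rV[R]_n) : 'M[R]_(p, q) :=
  \matrix_(a, b) pd i (fun y => F y a b) x.

Section MatrixDerivatives.
Variables (R : realType) (n : nat).
Local Notation e_ i := (basis_vec R (i : 'I_n)).
Implicit Types (U : set 'rV[R]_n) (x : 'rV[R]_n) (i j : 'I_n).

Lemma mpdE p q i (F : 'rV[R]_n -> 'M[R]_(p, q)) x a b :
  mpd i F x a b = pd i (fun y => F y a b) x.
Proof. by rewrite mpd.unlock mxE. Qed.

Definition mderivable p q i (F : 'rV[R]_n -> 'M[R]_(p, q)) x :=
  forall a b, derivable (fun y => F y a b) x (e_ i).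

Lemma smooth_mx_derivable p q U (F : 'rV[R]_n -> 'M[R]_(p, q)) x i :
  smooth_mx U F -> U x -> mderivable i F x.
Proof. by move=> sF Ux a b; exact: smooth_on_derivable (sF a b) Ux. Qed.

Lemma smooth_mx_mpd p q U (F : 'rV[R]_n -> 'M[R]_(p, q)) i : open U ->
  smooth_mx U F -> smooth_mx U (mpd i F).
Proof.
move=> oU sF a b; have := smooth_on_pd i (sF a b).
by apply: smooth_on_eq => // x _; rewrite mpdE.
Qed.

Lemma mpd_eq p q U (F H : 'rV[R]_n -> 'M[R]_(p, q)) x i : open U -> U x ->
  (forall y, U y -> F y = H y) -> mpd i F x = mpd i H x.
Proof.
move=> oU Ux FH; apply/matrixP => a b; rewrite !mpdE.
by apply: (pd_eq _ oU Ux) => y Uy; rewrite FH.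
Qed.

Lemma mpd_swap p q U (F : 'rV[R]_n -> 'M[R]_(p, q)) x i j : open U ->
  smooth_mx U F -> U x -> mpd i (mpd j F) x = mpd j (mpd i F) x.
Proof.
move=> oU sF Ux; apply/matrixP => a b; rewrite [LHS]mpdE [RHS]mpdE.
have E k : (fun y => mpd k F y a b) = pd k (fun y => F y a b).
  by apply/funext => y; rewrite mpdE.
by rewrite (E i) (E j) (smooth_on_pd_swap _ _ oU (sF a b) Ux).
Qed.

Lemma mderivableD p q (F H : 'rV[R]_n -> 'M[R]_(p, q)) x i :
  mderivable i F x -> mderivable i H x -> mderivable i (fun y => F y + H y) x.
Proof.
move=> dF dH a b; have := derivableD (dF a b) (dH a b).
by under [in X in _ -> X]eq_fun do rewrite entD.
Qed.

Lemma mpdD p q (F H : 'rV[R]_n -> 'M[R]_(p, q)) x i :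
  mderivable i F x -> mderivable i H x ->
  mpd i (fun y => F y + H y) x = mpd i F x + mpd i H x.
Proof.
move=> dF dH; apply/matrixP => a b; rewrite entD !mpdE -pdD //.
by congr (pd _ _ _); apply/funext => y; rewrite entD.
Qed.

Lemma mderivableN p q (F : 'rV[R]_n -> 'M[R]_(p, q)) x i :
  mderivable i F x -> mderivable i (fun y => - F y) x.
Proof.
move=> dF a b; have := derivableN (dF a b).
by under [in X in _ -> X]eq_fun do rewrite entN.
Qed.

Lemma mpdB p q (F H : 'rV[R]_n -> 'M[R]_(p, q)) x i :
  mderivable i F x -> mderivable i H x ->
  mpd i (fun y => F y - H y) x = mpd i F x - mpd i H x.
Proof.
move=> dF dH; apply/matrixP => a b; rewrite entD entN !mpdE -pdB //.
by congr (pd _ _ _); apply/funext => y; rewrite entD entN.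
Qed.

Lemma mderivableM p q r (F : 'rV[R]_n -> 'M[R]_(p, q))
    (H : 'rV[R]_n -> 'M[R]_(q, r)) x i :
  mderivable i F x -> mderivable i H x -> mderivable i (fun y => F y *m H y) x.
Proof.
move=> dF dH a b.
have -> : (fun y => (F y *m H y) a b) = (fun y => \sum_j F y a j * H y j b).
  by apply/funext => y; rewrite mxE.
by apply: derivable_sumfun => j; exact: derivableM.
Qed.

Lemma mpdM p q r (F : 'rV[R]_n -> 'M[R]_(p, q))
    (H : 'rV[R]_n -> 'M[R]_(q, r)) x i :
  mderivable i F x -> mderivable i H x ->
  mpd i (fun y => F y *m H y) x = mpd i F x *m H x + F x *m mpd i H x.
Proof.
move=> dF dH; apply/matrixP => a b; rewrite mpdE entD !entM.
have -> : (fun y => (F y *m H y) a b) = (fun y => \sum_j F y a j * H y j b).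
  by apply/funext => y; rewrite mxE.
rewrite pd_sum => [|j]; last exact: derivableM.
rewrite -big_split; apply: eq_bigr => j _.
by rewrite pdM // !mpdE.
Qed.

Lemma mderivableZ p q (c : 'rV[R]_n -> R) (F : 'rV[R]_n -> 'M[R]_(p, q)) x i :
  derivable c x (e_ i) -> mderivable i F x ->
  mderivable i (fun y => c y *: F y) x.
Proof.
move=> dc dF a b; have := derivableM dc (dF a b).
by under [in X in _ -> X]eq_fun do rewrite entZ.
Qed.

Lemma mpdZ p q (c : 'rV[R]_n -> R) (F : 'rV[R]_n -> 'M[R]_(p, q)) x i :
  derivable c x (e_ i) -> mderivable i F x ->
  mpd i (fun y => c y *: F y) x = pd i c x *: F x + c x *: mpd i F x.
Proof.
move=> dc dF; apply/matrixP => a b; rewrite entD !entZ !mpdE -pdM //.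
by congr (pd _ _ _); apply/funext => y; rewrite entZ.
Qed.

Lemma mderivable_sum p q m (F : 'I_m -> 'rV[R]_n -> 'M[R]_(p, q)) x i :
  (forall k, mderivable i (F k) x) -> mderivable i (fun y => \sum_k F k y) x.
Proof.
move=> dF a b.
have -> : (fun y => (\sum_k F k y) a b) = (fun y => \sum_k F k y a b).
  by apply/funext => y; rewrite summxE.
by apply: derivable_sumfun => k; exact: dF.
Qed.

Lemma mpd_sum p q m (F : 'I_m -> 'rV[R]_n -> 'M[R]_(p, q)) x i :
  (forall k, mderivable i (F k) x) ->
  mpd i (fun y => \sum_k F k y) x = \sum_k mpd i (F k) x.
Proof.
move=> dF; apply/matrixP => a b; rewrite summxE mpdE.
have -> : (fun y => (\sum_k F k y) a b) = (fun y => \sum_k F k y a b).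
  by apply/funext => y; rewrite summxE.
rewrite pd_sum => [|k]; last exact: dF.
by apply: eq_bigr => k _; rewrite mpdE.
Qed.

Lemma mderivable_tr p q (F : 'rV[R]_n -> 'M[R]_(p, q)) x i :
  mderivable i F x -> mderivable i (fun y => (F y)^T) x.
Proof.
move=> dF a b; have := dF b a.
by under [in X in _ -> X]eq_fun do rewrite entT.
Qed.

Lemma mpd_tr p q (F : 'rV[R]_n -> 'M[R]_(p, q)) x i :
  mpd i (fun y => (F y)^T) x = (mpd i F x)^T.
Proof.
apply/matrixP => a b; rewrite entT !mpdE.
by congr (pd _ _ _); apply/funext => y; rewrite entT.
Qed.

Lemma mpd_cst p q (C : 'M[R]_(p, q)) x i : mpd i (fun=> C) x = 0.
Proof. by apply/matrixP => a b; rewrite mpdE pd_cst mxE. Qed.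

End MatrixDerivatives.

(** * Connection and curvature matrices *)

Section MatrixIdentities.
Variables (R : comRingType) (n : nat).
Implicit Types g u v w p q r a b c : 'M[R]_n.

Lemma trmx_sub p q : (p - q)^T = p^T - q^T.
Proof. by apply/matrixP => i j; rewrite !mxE. Qed.

Lemma trmx_add p q : (p + q)^T = p^T + q^T.
Proof. by apply/matrixP => i j; rewrite !mxE. Qed.

(** Lets [ring] use one hypothesis, by comparing the differences of the two sides. *)
Local Lemma eq_of_sub (x y z t : R) : z - t = x - y -> x = y -> z = t.
Proof. by move=> E xy; apply/eqP; rewrite -subr_eq0 E xy subrr. Qed.

(** The letters [u], [v] stand for the connection matrices in directions i and j, [p] for the
    derivative of [v] along i and [q] for that of [u] along j. The premise equates the two mixed
    second derivatives of the metric [g], expanded by metric compatibility. *)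
Lemma curvature_skew_identity g u v p q : g^T = g ->
  p^T *m g + v^T *m (u^T *m g + g *m u)
    + ((u^T *m g + g *m u) *m v + g *m p) =
  q^T *m g + u^T *m (v^T *m g + g *m v)
    + ((v^T *m g + g *m v) *m u + g *m q) ->
  (g *m (p - q + (u *m v - v *m u)))^T = - (g *m (p - q + (u *m v - v *m u))).
Proof.
move=> gs /matrixP E; apply/matrixP => i j; move: (E i j).
rewrite trmx_mul gs trmx_add !trmx_sub !trmx_mul.
rewrite !(mulmxDr, mulmxDl, mulmxN, mulNmx) !mulmxA.
rewrite !(entD, entN) => H; apply: (eq_of_sub _ H); ring.
Qed.

(** The left side is the covariant derivative of the endomorphism k e g, with the derivative of [g]
    replaced by its value under a compatible connection [w]. As the metric is parallel, it factors
    out on the right. *)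
Lemma schur_identity (k d : R) (e w g : 'M[R]_n) :
  d *: (e *m g) + k *: (e *m (w^T *m g + g *m w))
    + w *m (k *: (e *m g)) - k *: (e *m g) *m w =
  (d *: e + k *: (e *m w^T + w *m e)) *m g.
Proof.
rewrite !(mulmxDl, mulmxDr) -!scalemxAl -!scalemxAr !mulmxDl !mulmxA.
by apply/matrixP => i j; rewrite !(entD, entN, entZ); ring.
Qed.

(** The left side is the derivative of j^T g j, where [p] is the connection pulled back along the
    map and [dj] the derivative of its Jacobian [j]. *)
Lemma pullback_metric_identity (g j p dj : 'M[R]_n) : g^T = g ->
  (dj^T *m g + j^T *m (p^T *m g + g *m p)) *m j + j^T *m g *m dj =
  (j^T *m g *m (p *m j + dj))^T + j^T *m g *m (p *m j + dj).
Proof.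
move=> gs; rewrite !(trmx_mul, trmx_add) trmxK gs.
rewrite !(mulmxDr, mulmxDl) !mulmxA.
by apply/matrixP => i k; rewrite !entD; ring.
Qed.

(* [duv] stands for the derivative along [u] of [v], and [su], [sv], [sw] for
   the mixed second derivatives of [u], [v], [w]. *)
Lemma bianchi2_identity u v w duv dvu dvw dwv dwu duw su sv sw :
  let Ouv := duv - dvu + (u *m v - v *m u) in
  let Ovw := dvw - dwv + (v *m w - w *m v) in
  let Owu := dwu - duw + (w *m u - u *m w) in
  (sv - su + ((dwu *m v + u *m dwv) - (dwv *m u + v *m dwu))
    + w *m Ouv - Ouv *m w)
  + (sw - sv + ((duv *m w + v *m duw) - (duw *m v + w *m duv))
    + u *m Ovw - Ovw *m u)
  + (su - sw + ((dvw *m u + w *m dvu) - (dvu *m w + u *m dvw))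
    + v *m Owu - Owu *m v) = 0.
Proof.
move=> Ouv Ovw Owu; apply/matrixP => i j; rewrite /Ouv /Ovw /Owu.
rewrite !(mulmxDr, mulmxDl, mulmxN, mulNmx) !mulmxA.
by rewrite !(entD, entN) [RHS]mxE; ring.
Qed.

(* Two connections [w] and [p] related by the gauge transformation [j]; the
   letters [jb], [wbc], [pbc], [jbc] stand for the derivatives along [b] of [j],
   [wc], [pc] and [jc]. *)
Lemma gauge_identity (j wb wc pb pc jb jc jbc jcb wbc wcb pbc pcb : 'M[R]_n) :
  jbc = jcb ->
  jb *m wc + j *m wbc = pbc *m j + pc *m jb + jbc ->
  jc *m wb + j *m wcb = pcb *m j + pb *m jc + jcb ->
  j *m wb = pb *m j + jb -> j *m wc = pc *m j + jc ->
  j *m (wbc - wcb + (wb *m wc - wc *m wb)) =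
    (pbc - pcb + (pb *m pc - pc *m pb)) *m j.
Proof.
move=> -> E1 E2 E3 E4.
rewrite mulmxDr !mulmxBr !mulmxA E3 E4 !mulmxDl -!mulmxA E3 E4.
have -> : j *m wbc = pbc *m j + pc *m jb + jcb - jb *m wc by rewrite -E1 addrC addKr.
have -> : j *m wcb = pcb *m j + pb *m jc + jcb - jc *m wb by rewrite -E2 addrC addKr.
rewrite !(mulmxDr, mulmxDl, mulmxN, mulNmx) !mulmxA.
by apply/matrixP => i k; rewrite !(entD, entN); ring.
Qed.

End MatrixIdentities.

(** The upper index is the row index, so that the partial derivative plus [conn_mx] is the covariant
    derivative on columns of components. Vectors being rows, transposes appear in [riem_form]. *)
HB.lock Definition conn_mx (R : realType) (n : nat) (G : 'rV[R]_n -> 'M[R]_n)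
    (i : 'I_n) (x : 'rV[R]_n) : 'M[R]_n :=
  \matrix_(l, k) christoffel G l i k x.

(** * Levi-Civita connection and curvature of a metric on an open set of coordinates *)

Section LocalCurvature.
Variables (R : realType) (n : nat) (U : set 'rV[R]_n) (G : 'rV[R]_n -> 'M[R]_n).
Hypotheses (oU : open U) (sG : smooth_mx U G).
Hypothesis Gsym : forall x, U x -> (G x)^T = G x.
Hypothesis Gpos : forall x, U x -> forall u : 'rV[R]_n, u != 0 ->
  0 < (u *m G x *m u^T) 0 0.
Local Notation e_ i := (basis_vec R (i : 'I_n)).
Implicit Types (x X Y Z W : 'rV[R]_n) (i j k l m : 'I_n).

Local Notation Gam := (conn_mx G).

Lemma conn_mxE i x l k : Gam i x l k = christoffel G l i k x.
Proof. by rewrite conn_mx.unlock mxE. Qed.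

(** The form d omega + omega wedge omega on two coordinate fields; these commute, so no bracket term
    occurs. *)
Definition curv_mx i j x : 'M[R]_n :=
  mpd i (Gam j) x - mpd j (Gam i) x + (Gam i x *m Gam j x - Gam j x *m Gam i x).
Local Notation Om := curv_mx.

Lemma G_unit x : U x -> G x \in unitmx.
Proof. by move=> Ux; apply: posdef_unit => u; exact: Gpos. Qed.

Lemma smooth_conn_mx i : smooth_mx U (Gam i).
Proof.
have sH := smooth_mx_inv oU sG G_unit.
move=> l k; rewrite (_ : (fun x => Gam i x l k) = christoffel G l i k); last first.
  by apply/funext => x; rewrite conn_mxE.
apply: smooth_onM => //; first exact: smooth_on_cst.
apply: smooth_on_sum => // m; apply: (smooth_onM oU (sH l m)).
apply: smooth_onB => //; first apply: smooth_onD => //.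
all: exact/smooth_on_pd/sG.
Qed.

Lemma pd_Gsym m a b x : U x -> pd m (fun y => G y a b) x = pd m (fun y => G y b a) x.
Proof.
by move=> Ux; apply: (pd_eq _ oU Ux) => y /Gsym {1}<-; rewrite mxE.
Qed.

Lemma christoffelC l j k x : U x -> christoffel G l j k x = christoffel G l k j x.
Proof.
move=> Ux; congr (_ * _); apply: eq_bigr => m _; congr (_ * (_ - _)).
  by rewrite addrC.
exact: pd_Gsym.
Qed.

Lemma conn_mxC l j k x : U x -> Gam j x l k = Gam k x l j.
Proof. by move=> Ux; rewrite !conn_mxE christoffelC. Qed.

(** Koszul formula: [G] cancels the inverse metric in [christoffel], leaving the symbols of the
    first kind. *)
Lemma conn_mx_low i l k x : U x -> (G x *m Gam i x) l k =
  2^-1 * (mpd i G x l k + mpd k G x l i - mpd l G x i k).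
Proof.
move=> Ux.
pose c : 'cV[R]_n := \col_m (2^-1 * (mpd i G x m k + mpd k G x m i - mpd m G x i k)).
transitivity ((G x *m (invmx (G x) *m c)) l 0); last first.
  by rewrite mulmxA mulmxV ?G_unit // mul1mx mxE.
rewrite !entM; apply: eq_bigr => m _; congr (_ * _).
rewrite conn_mxE entM /christoffel mulr_sumr; apply: eq_bigr => p _.
by rewrite (mxE _ (fun p _ => _)) !mpdE mulrCA.
Qed.

Lemma metric_compat i x : U x ->
  mpd i G x = (Gam i x)^T *m G x + G x *m Gam i x.
Proof.
move=> Ux; have -> : (Gam i x)^T *m G x = (G x *m Gam i x)^T.
  by rewrite trmx_mul Gsym.
apply/matrixP => a b; rewrite entD [X in X + _]mxE !conn_mx_low //.
have S m p q : mpd m G x p q = mpd m G x q p by rewrite !mpdE pd_Gsym.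
move: (S i b a) (S a b i) (S b a i).
move: (mpd i G x a b) (mpd i G x b a) (mpd a G x b i) (mpd a G x i b)
  (mpd b G x a i) (mpd b G x i a) => p1 p2 p3 p4 p5 p6; lra.
Qed.

(** Differentiating [metric_compat] once more turns the symmetry of the second derivatives of [G]
    into this skewness. *)
Lemma curv_mx_skew i j x : U x ->
  (G x *m Om i j x)^T = - (G x *m Om i j x).
Proof.
move=> Ux; have sGam := smooth_conn_mx.
have dG k y : U y -> mderivable k G y by exact: smooth_mx_derivable.
have dGam k l y : U y -> mderivable k (Gam l) y by exact/smooth_mx_derivable.
have dd a b : mpd a (mpd b G) x =
    (mpd a (Gam b) x)^T *m G x + (Gam b x)^T *m mpd a G x
    + (mpd a G x *m Gam b x + G x *m mpd a (Gam b) x).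
  rewrite (mpd_eq _ oU Ux (@metric_compat b)) mpdD.
  - rewrite mpdM; [|exact/mderivable_tr/dGam|exact: dG].
    by rewrite mpdM; [rewrite mpd_tr|exact: dG|exact: dGam].
  - by apply: mderivableM; [exact/mderivable_tr/dGam|exact: dG].
  - by apply: mderivableM; [exact: dG|exact: dGam].
have := mpd_swap i j oU sG Ux; rewrite (dd i j) (dd j i) (metric_compat i Ux) (metric_compat j Ux).
by move=> E; apply: curvature_skew_identity E; exact: Gsym.
Qed.

Definition riem_form i j x Z W : R :=
  (Z *m (Om i j x)^T *m G x *m W^T) 0 0.

Lemma riem_upE i j k l x : riem_up G i j k l x = Om i j x l k.
Proof.
rewrite /riem_up sumrB /curv_mx !(entD, entN) !mpdE !entM.
congr (_ - _ + (_ - _)).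
- by congr (pd _ _ _); apply/funext => y; rewrite conn_mxE.
- by congr (pd _ _ _); apply/funext => y; rewrite conn_mxE.
- by apply: eq_bigr => m _; rewrite !conn_mxE mulrC.
- by apply: eq_bigr => m _; rewrite !conn_mxE mulrC.
Qed.

Lemma riemE x X Y Z W : riem G x X Y Z W =
  \sum_i \sum_j X 0 i * Y 0 j * riem_form i j x Z W.
Proof.
apply: eq_bigr => i _; apply: eq_bigr => j _.
rewrite /riem_form -!mulmxA mxE mulr_sumr; apply: eq_bigr => k _.
rewrite mulmxA mxE mulr_sumr mulr_sumr; apply: eq_bigr => l _.
rewrite mxE [W^T _ _]mxE mulr_sumr mulr_suml !mulr_sumr.
by apply: eq_bigr => m _; rewrite riem_upE [(_)^T _ _]mxE; ring.
Qed.

Lemma curv_mx_anti i j x : Om j i x = - Om i j x.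
Proof.
by apply/matrixP => a b; rewrite /curv_mx !(entD, entN); ring.
Qed.

Lemma riem_form_linl i j x W : lin1 (fun Z => riem_form i j x Z W).
Proof. by move=> a u v; rewrite /riem_form !mulmxDl -!scalemxAl !mxE. Qed.

Lemma riem_form_linr i j x Z : lin1 (riem_form i j x Z).
Proof.
by move=> a u v; rewrite /riem_form linearP /= mulmxDr -scalemxAr !mxE.
Qed.

Lemma riem_basis i j x Z W : riem G x (e_ i) (e_ j) Z W = riem_form i j x Z W.
Proof.
rewrite riemE (bigD1 i) //= (bigD1 j) //= !basis_vecE !eqxx !mul1r.
rewrite big1 ?addr0 => [|b /negPf bj]; last by rewrite basis_vecE bj mulr0 mul0r.
rewrite big1 ?addr0 // => a /negPf ai.
by rewrite big1 // => b _; rewrite basis_vecE ai !mul0r.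
Qed.

Lemma riem_multilinear x : multilinear4 (riem G x).
Proof.
split=> [Y Z W|X Z W|X Y W|X Y Z] a u v; rewrite !riemE mulr_sumr -big_split;
  apply: eq_bigr => i _; rewrite /= mulr_sumr -big_split;
  apply: eq_bigr => j _ /=; rewrite ?riem_form_linl ?riem_form_linr ?mxE; ring.
Qed.

Lemma lin1_eq0 (f : 'rV[R]_n -> R) u : lin1 f -> (forall a, f (e_ a) = 0) -> f u = 0.
Proof. by move=> lf f0; rewrite (lin1_sum _ lf) big1 // => a _; rewrite f0 mulr0. Qed.

(** The connection has no torsion: by symmetry of the lower indices of the Christoffel symbols, both
    the derivative terms and the product terms cancel in pairs. *)
Lemma curv_mx_bianchi1 i j k l x : U x ->
  Om i j x l k + Om j k x l i + Om k i x l j = 0.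
Proof.
move=> Ux; rewrite /curv_mx !(entD, entN).
have E a b c : mpd a (Gam b) x l c = mpd a (Gam c) x l b.
  rewrite !mpdE; apply: (pd_eq _ oU Ux) => y; exact: conn_mxC.
have S a b c : (Gam a x *m Gam b x) l c = (Gam a x *m Gam c x) l b.
  by rewrite !entM; apply: eq_bigr => m _; rewrite (conn_mxC m b).
by rewrite (E i k j) (E j k i) (E k j i) (S i k j) (S j k i) (S k j i); ring.
Qed.

Lemma riem_curvature_like x : U x -> curvature_like (riem G x).
Proof.
move=> Ux; have lR := riem_multilinear x; have [l1 l2 l3 l4] := lR.
split=> //.
- move=> X Y Z W; rewrite !riemE exchange_big -sumrN; apply: eq_bigr => j _.
  rewrite -sumrN; apply: eq_bigr => i _.
  rewrite /riem_form curv_mx_anti linearN mulmxN !mulNmx mxE; ring.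
- move=> X Y Z W; rewrite !riemE -sumrN; apply: eq_bigr => i _.
  rewrite -sumrN; apply: eq_bigr => j _; rewrite -mulrN; congr (_ * _).
  rewrite /riem_form -[RHS]mulN1r.
  have -> : (W *m (Om i j x)^T *m G x *m Z^T) 0 0
      = (Z *m (G x *m Om i j x) *m W^T) 0 0.
    rewrite -[LHS](mxE tt (fun a b => (W *m (Om i j x)^T *m G x *m Z^T) b a)).
    have -> : \matrix[tt]_(a, b) (W *m (Om i j x)^T *m G x *m Z^T) b a
        = (W *m (Om i j x)^T *m G x *m Z^T)^T.
      by apply/matrixP => a b; rewrite !mxE.
    by rewrite !trmx_mul !trmxK Gsym // !mulmxA.
  have := curv_mx_skew i j Ux; rewrite trmx_mul Gsym // => E.
  by rewrite -(mulmxA Z) E mulmxN mulNmx mxE mulN1r.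
- move=> X Y Z W.
  (* The cyclic sum is linear in each of [X], [Y], [Z], so it need only vanish on coordinate
     vectors; [W] stays arbitrary. *)
  apply: (lin1_eq0 (f := fun X => riem G x X Y Z W + _ + _)) => [a u v|i].
    by rewrite l1 l2 l3; ring.
  apply: (lin1_eq0 (f := fun Y => riem G x _ Y Z W + _ + _)) => [a u v|j].
    by rewrite l1 l2 l3; ring.
  apply: (lin1_eq0 (f := fun Z => riem G x _ _ Z W + _ + _)) => [a u v|k].
    by rewrite l1 l2 l3; ring.
  rewrite !riem_basis /riem_form -!entD -!mulmxDl.
  rewrite (_ : e_ k *m (Om i j x)^T + e_ i *m (Om j k x)^T
    + e_ j *m (Om k i x)^T = 0) ?mul0mx ?mxE //.
  have rT (A : 'M[R]_n) a l : (e_ a *m A^T) 0 l = A l a by rewrite -rowE !mxE.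
  apply/rowP => l; rewrite !entD !rT [RHS]mxE.
  exact: curv_mx_bianchi1.
Qed.

(** Each line is a derivative plus a commutator with the connection: the indices of the 2-form get
    no Christoffel terms, since those would cancel in the cyclic sum of a torsion-free
    connection. *)
Lemma curv_mx_bianchi2 i j m x : U x ->
  (mpd m (Om i j) x + Gam m x *m Om i j x - Om i j x *m Gam m x)
  + (mpd i (Om j m) x + Gam i x *m Om j m x - Om j m x *m Gam i x)
  + (mpd j (Om m i) x + Gam j x *m Om m i x - Om m i x *m Gam j x) = 0.
Proof.
move=> Ux; have sGam := smooth_conn_mx.
have d1 k l : mderivable k (Gam l) x by exact: smooth_mx_derivable.
have d2 k a b : mderivable k (mpd a (Gam b)) x.
  by apply: smooth_mx_derivable Ux; exact: smooth_mx_mpd.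
have d3 k a b : mderivable k (fun y => Gam a y *m Gam b y) x.
  exact: mderivableM.
have dOm k a b : mpd k (Om a b) x = mpd k (mpd a (Gam b)) x - mpd k (mpd b (Gam a)) x
   + ((mpd k (Gam a) x *m Gam b x + Gam a x *m mpd k (Gam b) x)
   - (mpd k (Gam b) x *m Gam a x + Gam b x *m mpd k (Gam a) x)).
  rewrite /curv_mx mpdD.
  - by rewrite !mpdB // !mpdM.
  - by apply: mderivableD => //; exact: mderivableN.
  - by apply: mderivableD => //; exact: mderivableN.
rewrite (dOm m i j) (dOm i j m) (dOm j m i) /curv_mx.
rewrite (mpd_swap m i oU (sGam j) Ux) (mpd_swap m j oU (sGam i) Ux).
rewrite (mpd_swap i j oU (sGam m) Ux); exact: bianchi2_identity.
Qed.

End LocalCurvature.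

(** * Schur's lemma *)

Section Schur.
Variables (R : realType) (n : nat) (U : set 'rV[R]_n) (G : 'rV[R]_n -> 'M[R]_n).
Hypotheses (oU : open U) (sG : smooth_mx U G).
Hypothesis Gsym : forall x, U x -> (G x)^T = G x.
Hypothesis Gpos : forall x, U x -> forall u : 'rV[R]_n, u != 0 ->
  0 < (u *m G x *m u^T) 0 0.
Hypothesis n3 : (3 <= n)%N.
Variable K : 'rV[R]_n -> R.
Hypothesis riemK : forall x, U x -> forall X Y Z W, riem G x X Y Z W =
  K x * (ip (G x) Y Z * ip (G x) X W - ip (G x) X Z * ip (G x) Y W).
Local Notation e_ i := (basis_vec R (i : 'I_n)).
Local Notation Gam := (conn_mx G).
Local Notation Om := (curv_mx G).
Implicit Types (x : 'rV[R]_n) (i j k l m : 'I_n).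

Let E i j : 'M[R]_n := delta_mx i j - delta_mx j i.

Lemma bilin_mx_inj (p q : nat) (A B : 'M[R]_(p, q)) :
  (forall (Z : 'rV_p) (W : 'rV_q), (Z *m A *m W^T) 0 0 = (Z *m B *m W^T) 0 0) ->
  A = B.
Proof.
move=> AB; apply/matrixP => a b; have := AB (delta_mx 0 a) (delta_mx 0 b).
by rewrite -!rowE trmx_delta -!colE !mxE.
Qed.

Let E_tr i j : (E i j)^T = - E i j.
Proof. by rewrite /E linearB /= !trmx_delta opprB. Qed.

(** On columns, [E i j *m G x] is the endomorphism sending Z to g(d_j, Z) d_i - g(d_i, Z) d_j. *)
Lemma const_curv_mx i j x : U x -> Om i j x = K x *: (E i j *m G x).
Proof.
move=> Ux; have uG := G_unit Gpos Ux.
suff H : (Om i j x)^T *m G x = (K x *: (E i j *m G x))^T *m G x.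
  by apply: trmx_inj; rewrite -[LHS](mulmxK uG) H mulmxK.
apply: bilin_mx_inj => Z W.
rewrite !(mulmxA Z) -[LHS](riem_basis G) (riemK Ux).
have -> : (K x *: (E i j *m G x))^T =
    K x *: (G x *m delta_mx j i - G x *m delta_mx i j).
  have -> : (K x *: (E i j *m G x))^T = K x *: (E i j *m G x)^T.
    by apply/matrixP => a b; rewrite !mxE.
  by rewrite trmx_mul Gsym // E_tr opprB mulmxBr.
have H a b : (Z *m (G x *m delta_mx a b) *m G x *m W^T) 0 0
    = ip (G x) (e_ a) Z * ip (G x) (e_ b) W.
  rewrite -(mul_delta_mx (0 : 'I_1)) (ipC (Gsym Ux) (e_ a)) /ip.
  rewrite [(e_ a)^T]trmx_delta !mulmxA -!(mulmxA (_ *m delta_mx a 0)).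
  by rewrite [LHS]mxE big_ord1.
by rewrite -scalemxAr -!scalemxAl mulmxBr !mulmxBl entZ entD entN !H.
Qed.

Let ne2 m : exists i j, [/\ i != j, i != m & j != m].
Proof.
have : (1 < #|~: [set m]|)%N by rewrite cardsC1 card_ord -ltnS prednK // (leq_trans _ n3).
case/card_gt1P => i [j]; rewrite !inE => -[im jm ij].
by exists i, j.
Qed.

(** [K] is only an arbitrary function satisfying [riemK]. For i and j distinct, the entry (i, j) of
    [Om i j] is [K] times the positive coefficient [G x j j], which exhibits [K] as a quotient of
    smooth functions. *)
Lemma smooth_const_curv : smooth_on U K.
Proof.
have [i [j [ij _ _]]] := ne2 (Ordinal (leq_trans (isT : (0 < 3)%N) n3)).
have Gjj x : U x -> 0 < G x j j.
  move=> Ux; have : e_ j != 0.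
    by apply/eqP => /rowP /(_ j) /eqP; rewrite basis_vecE eqxx mxE oner_eq0.
  by move=> /(Gpos Ux); rewrite -rowE trmx_delta -colE !mxE.
have sOm : smooth_on U (fun x => Om i j x i j).
  have sGam := smooth_conn_mx oU sG Gpos.
  have : smooth_mx U (Om i j).
    have H1 a b : smooth_mx U (mpd a (Gam b)) by exact: smooth_mx_mpd.
    have H2 a b : smooth_mx U (fun x => Gam a x *m Gam b x) by exact: smooth_mx_mul.
    move=> a b; rewrite /curv_mx.
    have := smooth_onD oU (smooth_onB oU (H1 i j a b) (H1 j i a b))
      (smooth_onB oU (H2 i j a b) (H2 j i a b)).
    by apply: smooth_on_eq => // x _; rewrite !(entD, entN).
  by apply.
have := smooth_onM oU sOm (smooth_onV oU (sG j j) (fun x Ux => lt0r_neq0 (Gjj x Ux))).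
apply: smooth_on_eq => // x Ux.
rewrite const_curv_mx // entZ /E mulmxBl entD entN.
have H (a b c : 'I_n) : (delta_mx a b *m G x) c j = (c == a)%:R * G x b j.
  rewrite entM (bigD1 b) //= mxE eqxx andbT big1 ?addr0 // => k /negPf kb.
  by rewrite mxE kb andbF mul0r.
by rewrite !H eqxx (negPf ij) mul0r subr0 mul1r mulfK // lt0r_neq0 // Gjj.
Qed.

(** For i, j, m distinct, inserting K E G for the curvature in the second Bianchi identity and
    cancelling [G] leaves only derivatives of [K], because the connection terms vanish in the cyclic
    sum. *)
Lemma schur_pd m x : U x -> pd m K x = 0.
Proof.
move=> Ux; have [i [j [ij im jm]]] := ne2 m.
have uG := G_unit Gpos Ux.
have sGam := smooth_conn_mx oU sG Gpos.
pose w a := Gam a x.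
have dK a : derivable K x (e_ a) by exact: smooth_on_derivable smooth_const_curv Ux.
have dG a : mderivable a G x by exact: smooth_mx_derivable Ux.
have dEG a b c : mderivable a (fun y => E b c *m G y) x.
  by apply: mderivableM => // p q; exact: derivable_cst.
have dOm a b c : mpd a (Om b c) x + w a *m Om b c x - Om b c x *m w a =
    (pd a K x *: E b c + K x *: (E b c *m (w a)^T + w a *m E b c)) *m G x.
  rewrite (mpd_eq a oU Ux (@const_curv_mx b c)) mpdZ // mpdM //.
  rewrite mpd_cst mul0mx add0r (metric_compat oU Gsym Gpos) // const_curv_mx //.
  exact: schur_identity.
(* Again absence of torsion: the six terms cancel in pairs by [conn_mxC]. *)
have cyc : w m *m E i j + w i *m E j m + w j *m E m i = 0.
  have H a b c p q : (w a *m E b c) p q =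
      w a p b * (q == c)%:R - w a p c * (q == b)%:R.
    have mul_deltaE d e : (w a *m delta_mx d e) p q = w a p d * (q == e)%:R.
      rewrite entM (bigD1 d) //= mxE eqxx /= big1 ?addr0 // => k /negPf kd.
      by rewrite mxE kd mulr0.
    by rewrite /E mulmxBr entD entN !mul_deltaE.
  apply/matrixP => p q; rewrite !entD !H [RHS]mxE /w.
  by rewrite (conn_mxC oU Gsym p m i) // (conn_mxC oU Gsym p m j) //
    (conn_mxC oU Gsym p i j) //; ring.
have cycT : E i j *m (w m)^T + E j m *m (w i)^T + E m i *m (w j)^T = 0.
  have -> : E i j *m (w m)^T + E j m *m (w i)^T + E m i *m (w j)^T =
     - (w m *m E i j + w i *m E j m + w j *m E m i)^T.
    rewrite !trmx_add !trmx_mul !E_tr !mulNmx.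
    by apply/matrixP => p q; rewrite !(entD, entN); ring.
  by rewrite cyc trmx0 oppr0.
have := curv_mx_bianchi2 oU sG Gpos i j m Ux.
rewrite -!/(w _) !dOm -!mulmxDl => /(congr1 (fun A => A *m invmx (G x))).
rewrite mulmxK // mul0mx.
set L := (X in X = 0 -> _).
have -> : L = pd m K x *: E i j + pd i K x *: E j m + pd j K x *: E m i +
    K x *: ((E i j *m (w m)^T + E j m *m (w i)^T + E m i *m (w j)^T)
      + (w m *m E i j + w i *m E j m + w j *m E m i)).
  by apply/matrixP => p q; rewrite /L !(entD, entZ); ring.
(* At the entry (i, j), [E i j] is 1 while [E j m] and [E m i] are 0, so only the derivative along
   [m] is left. *)
rewrite cyc cycT addr0 scaler0 addr0 => /matrixP /(_ i j).
rewrite /E !(entD, entZ, entN) !mxE !eqxx (negPf ij) (negPf im) (negPf jm).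
by rewrite /=; lra.
Qed.

End Schur.

(** * Change of coordinates *)

Section Naturality.
Variables (R : realType) (n : nat).
Local Notation e_ i := (basis_vec R (i : 'I_n)).
Variables (U V : set 'rV[R]_n) (G G' : 'rV[R]_n -> 'M[R]_n).
Hypotheses (oU : open U) (sG : smooth_mx U G).
Hypothesis Gsym : forall x, U x -> (G x)^T = G x.
Hypothesis Gpos : forall x, U x -> forall u : 'rV[R]_n, u != 0 ->
  0 < (u *m G x *m u^T) 0 0.
Hypotheses (oV : open V) (sG' : smooth_mx V G').
Hypothesis G'sym : forall y, V y -> (G' y)^T = G' y.
Hypothesis G'pos : forall y, V y -> forall u : 'rV[R]_n, u != 0 ->
  0 < (u *m G' y *m u^T) 0 0.
Variable phi : 'rV[R]_n -> 'rV[R]_n.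
Hypothesis sphi : forall a, smooth_on V (fun y => phi y 0 a).
Hypothesis phiU : forall y, V y -> U (phi y).

Definition jac_mx (y : 'rV[R]_n) : 'M[R]_n :=
  \matrix_(a, b) pd b (fun y => phi y 0 a) y.
Local Notation J := jac_mx.
Hypothesis G'E : forall y, V y -> G' y = (J y)^T *m G (phi y) *m J y.
Implicit Types (x y : 'rV[R]_n) (a b c d : 'I_n).

Local Notation Gam := (conn_mx G).
Local Notation Gam' := (conn_mx G').
Local Notation Om := (curv_mx G).
Local Notation Om' := (curv_mx G').

Lemma jacE y a b : J y a b = pd b (fun y => phi y 0 a) y.
Proof. by rewrite mxE. Qed.

(** The connection form of [G] pulled back along [phi], evaluated on the [c]-th coordinate field. *)
Let pull c y : 'M[R]_n := \sum_a J y a c *: Gam a (phi y).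

Lemma smooth_jac : smooth_mx V J.
Proof.
move=> a b; have := smooth_on_pd b (sphi a).
by apply: smooth_on_eq => // y _; rewrite jacE.
Qed.

(** The determinant of the Jacobian divides that of [G'], which is invertible; no inverse of [phi]
    is called upon. *)
Lemma jac_unit y : V y -> J y \in unitmx.
Proof.
move=> Vy; have := G_unit G'pos Vy; rewrite G'E // !unitmxE !det_mulmx.
by rewrite unitrM => /andP[].
Qed.

Lemma mpd_comp p q (F : 'rV[R]_n -> 'M[R]_(p, q)) y b : smooth_mx U F -> V y ->
  mderivable b (fun z => F (phi z)) y /\
  mpd b (fun z => F (phi z)) y = \sum_a J y a b *: mpd a F (phi y).
Proof.
move=> sF Vy.
have H i j := pd_comp (b := b) oU (sF i j) (phiU Vy)
  (fun a => smooth_on_derivable (i := b) (sphi a) Vy).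
split=> [i j|]; first by have [] := H i j.
apply/matrixP => i j; rewrite mpdE; have [_] := H i j; rewrite /comp => ->.
rewrite summxE; apply: eq_bigr => a _.
by rewrite entZ mpdE jacE mulrC.
Qed.

Lemma mpd_jacC y a b c : V y -> mpd b J y a c = mpd c J y a b.
Proof.
move=> Vy; rewrite !mpdE.
have E d : (fun z => J z a d) = pd d (fun z => phi z 0 a).
  by apply/funext => z; rewrite jacE.
by rewrite (E b) (E c) (smooth_on_pd_swap b c oV (sphi a) Vy).
Qed.

(* The right-hand side defines a symmetric connection compatible with [G'], so
   it is the Levi-Civita connection of [G']. *)
Lemma conn_mx_pullback b y : V y ->
  J y *m Gam' b y = pull b y *m J y + mpd b J y.
Proof.
move=> Vy; have Ux := phiU Vy; have uG := G_unit Gpos Ux.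
have uJ := jac_unit Vy.
have uJG : (J y)^T *m G (phi y) \in unitmx by rewrite unitmx_mul unitmx_tr uJ.
(* The right-hand side with its upper index lowered by [G']: its symmetric part gives the derivative
   of [G'] ([dG']), and its symmetry in [c] and the column index ([WC]) is the absence of
   torsion. *)
pose W c := (J y)^T *m G (phi y) *m (pull c y *m J y + mpd c J y).
suff H : G' y *m Gam' b y = W b.
  apply: (can_inj (mulKmx uJG)).
  by rewrite mulmxA -G'E.
have dJ c : mderivable c J y by exact: smooth_mx_derivable smooth_jac Vy.
have dGphi c : mderivable c (fun z => G (phi z)) y by have [] := mpd_comp c sG Vy.
have dG' c : mpd c G' y = (W c)^T + W c.
  rewrite (mpd_eq c oV Vy G'E) mpdM //; last first.
    by apply: mderivableM => //; exact: mderivable_tr.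
  rewrite mpdM //; last exact: mderivable_tr.
  rewrite mpd_tr; have [_ ->] := mpd_comp c sG Vy.
  have -> : \sum_a J y a c *: mpd a G (phi y) =
      (pull c y)^T *m G (phi y) + G (phi y) *m pull c y.
    rewrite /pull mulmx_sumr raddf_sum mulmx_suml -big_split.
    apply: eq_bigr => a _ /=; rewrite (metric_compat oU Gsym Gpos) //.
    by rewrite linearZ /= -scalemxAl -scalemxAr -scalerDr.
  exact/pullback_metric_identity/Gsym.
have WC l c d : W c l d = W d l c.
  rewrite /W !entM; apply: eq_bigr => m _; congr (_ * _).
  rewrite !entD mpd_jacC //; congr (_ + _); rewrite /pull !mulmx_suml !summxE.
  transitivity (\sum_a \sum_k J y a c * J y k d * Gam a (phi y) m k).
    apply: eq_bigr => a _; rewrite -scalemxAl entZ entM mulr_sumr.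
    by apply: eq_bigr => k _; ring.
  rewrite exchange_big; apply: eq_bigr => a _; rewrite -scalemxAl entZ entM mulr_sumr.
  apply: eq_bigr => k _; rewrite (conn_mxC oU Gsym m k a) //; ring.
(* The Koszul formula turns into half of six entries of [W]; by symmetry four cancel and the other
   two are both [W b l c]. *)
apply/matrixP => l c; rewrite (conn_mx_low G'pos) // !dG' !entD !entT.
by rewrite (WC c b l) (WC l c b) (WC b c l); field.
Qed.

(** By [conn_mx_pullback] the Jacobian is a gauge transformation between [Gam'] and [pull], so
    curvatures correspond by conjugation, and the curvature of [pull] is the pullback of that of
    [G]. *)
Lemma curv_mx_pullback b c y : V y -> J y *m Om' b c y =
  (\sum_d \sum_a (J y d b * J y a c) *: Om d a (phi y)) *m J y.
Proof.
move=> Vy; have Ux := phiU Vy.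
have sGam := smooth_conn_mx oU sG Gpos; have sGam' := smooth_conn_mx oV sG' G'pos.
have dJ k z : V z -> mderivable k J z by exact: smooth_mx_derivable smooth_jac.
have dmJ k l z : V z -> mderivable k (mpd l J) z.
  by apply: smooth_mx_derivable; apply: smooth_mx_mpd => //; exact: smooth_jac.
have dGam' k l z : V z -> mderivable k (Gam' l) z by exact: smooth_mx_derivable.
have dGphi k l : mderivable k (fun z => Gam l (phi z)) y.
  by have [] := mpd_comp k (sGam l) Vy.
have dJent k p q : derivable (fun z => J z p q) y (e_ k) by exact: dJ.
have dpull k l : mderivable k (pull l) y.
  by apply: mderivable_sum => a; exact: mderivableZ.
have mpull k l : mpd k (pull l) y = \sum_a (mpd k J y a l *: Gam a (phi y)
    + \sum_d (J y d k * J y a l) *: mpd d (Gam a) (phi y)).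
  rewrite mpd_sum; last by move=> a; exact: mderivableZ.
  apply: eq_bigr => a _; rewrite mpdZ // mpdE; congr (_ + _).
  have [_ ->] := mpd_comp k (sGam a) Vy; rewrite scaler_sumr.
  by apply: eq_bigr => d _; rewrite scalerA mulrC.
(* The second derivatives of [phi] are symmetric and drop out of the difference. *)
have curl : mpd b (pull c) y - mpd c (pull b) y =
    \sum_d \sum_a (J y d b * J y a c) *: (mpd d (Gam a) (phi y) - mpd a (Gam d) (phi y)).
  rewrite !mpull !big_split /= opprD addrACA.
  have -> : \sum_a mpd b J y a c *: Gam a (phi y) =
      \sum_a mpd c J y a b *: Gam a (phi y).
    by apply: eq_bigr => a _; rewrite mpd_jacC.
  rewrite subrr add0r exchange_big /= -sumrB; apply: eq_bigr => d _.
  rewrite -sumrB; apply: eq_bigr => a _.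
  by rewrite scalerBr (mulrC (J y d b)).
have prod k l : pull k y *m pull l y =
    \sum_d \sum_a (J y d k * J y a l) *: (Gam d (phi y) *m Gam a (phi y)).
  rewrite /pull mulmx_suml; apply: eq_bigr => d _; rewrite mulmx_sumr.
  by apply: eq_bigr => a _; rewrite -scalemxAl -scalemxAr scalerA.
have -> : \sum_d \sum_a (J y d b * J y a c) *: Om d a (phi y) =
    mpd b (pull c) y - mpd c (pull b) y
    + (pull b y *m pull c y - pull c y *m pull b y).
  rewrite curl !prod [X in _ - X]exchange_big /= -sumrB -big_split.
  apply: eq_bigr => d _; rewrite /= -sumrB -big_split; apply: eq_bigr => a _ /=.
  by rewrite (mulrC (J y a c)) -scalerBr -scalerDr.
have dE k l : mpd k J y *m Gam' l y + J y *m mpd k (Gam' l) y =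
    mpd k (pull l) y *m J y + pull l y *m mpd k J y + mpd k (mpd l J) y.
  have := mpd_eq k oV Vy (@conn_mx_pullback l).
  rewrite mpdM; [|exact: dJ|exact: dGam'].
  rewrite mpdD; [|by apply: mderivableM; [exact: dpull|exact: dJ]|exact: dmJ].
  by rewrite mpdM; [|exact: dpull|exact: dJ].
apply: (gauge_identity (mpd_swap b c oV smooth_jac Vy) (dE b c) (dE c b));
  exact: conn_mx_pullback.
Qed.

Lemma riem_pullback X Y Z W y : V y -> riem G' y X Y Z W =
  riem G (phi y) (X *m (J y)^T) (Y *m (J y)^T) (Z *m (J y)^T) (W *m (J y)^T).
Proof.
move=> Vy; pose f (X' : 'rV[R]_n) := X' *m (J y)^T.
rewrite -!/(f _).
have formE b c : riem_form G' b c y Z W =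
    \sum_d \sum_a J y d b * J y a c * riem_form G d a (phi y) (f Z) (f W).
  rewrite /riem_form G'E // /f.
  have -> : Z *m (Om' b c y)^T *m ((J y)^T *m G (phi y) *m J y) *m W^T =
     Z *m (J y *m Om' b c y)^T *m G (phi y) *m (J y *m W^T).
    by rewrite trmx_mul !mulmxA.
  rewrite curv_mx_pullback // trmx_mul [in RHS]trmx_mul trmxK !mulmxA.
  rewrite raddf_sum mulmx_sumr !mulmx_suml summxE; apply: eq_bigr => d _.
  rewrite raddf_sum mulmx_sumr !mulmx_suml summxE; apply: eq_bigr => a _ /=.
  by rewrite linearZ /= -scalemxAr -!scalemxAl entZ !mulmxA.
have fE X' d : f X' 0 d = \sum_b X' 0 b * J y d b.
  by rewrite /f entM; apply: eq_bigr => b _; rewrite entT.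
rewrite !riemE.
transitivity (\sum_b \sum_c \sum_d \sum_a X 0 b * J y d b * (Y 0 c * J y a c)
    * riem_form G d a (phi y) (f Z) (f W)).
  apply: eq_bigr => b _; apply: eq_bigr => c _.
  rewrite formE mulr_sumr; apply: eq_bigr => d _; rewrite mulr_sumr.
  by apply: eq_bigr => a _; ring.
transitivity (\sum_d \sum_a \sum_b \sum_c X 0 b * J y d b * (Y 0 c * J y a c)
    * riem_form G d a (phi y) (f Z) (f W)); last first.
  apply: eq_bigr => d _; apply: eq_bigr => a _.
  rewrite !fE big_distrlr /= mulr_suml; apply: eq_bigr => b _.
  by rewrite mulr_suml.
under eq_bigr => b _ do rewrite exchange_big.
rewrite exchange_big; apply: eq_bigr => d _.
under eq_bigr => b _ do rewrite exchange_big.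
by rewrite exchange_big.
Qed.

Lemma ip_pullback u v y : V y ->
  ip (G' y) u v = ip (G (phi y)) (u *m (J y)^T) (v *m (J y)^T).
Proof. by move=> Vy; rewrite /ip G'E // trmx_mul trmxK !mulmxA. Qed.

End Naturality.

(** * Bump functions *)

Section FlatFunctions.
Variable R : realType.
Implicit Types (p q : {poly R}) (s t h : R).

(** The polynomial makes the family stable under derivation, so that smoothness of exp(-1/t)
    extended by 0 is an iteration of [flat_next]. *)
Definition flat p t : R := if 0 < t then p.[t^-1] * expR (- t^-1) else 0.

(* [flat (flat_next p)] is the derivative of [flat p]. *)
Definition flat_next p : {poly R} := 'X^2 * (p - p^`()).

Lemma poly_le_expR p : exists2 C, 0 <= C &
  forall s, 0 <= s -> `|p.[s]| <= C * expR s.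
Proof.
exists (\sum_(i < size p) `|p`_i| * (i`!)%:R) => [|s s0].
  by apply: sumr_ge0 => i _; rewrite mulr_ge0.
rewrite horner_coef mulr_suml (le_trans (ler_norm_sum _ _ _)) //.
apply: ler_sum => i _; rewrite normrM -mulrA ler_wpM2l // normrX ger0_norm //.
case: (nat_of_ord i) => [|k].
  by rewrite expr0 mul1r (le_trans _ (expR_ge1Dx s)) // lerDl.
rewrite mulrC -ler_pdivrMr ?ltr0n ?fact_gt0 //.
by apply: le_trans (expR_ge1Dxn k s0); rewrite lerDr.
Qed.

Lemma flat_le_sqr p : exists2 C, 0 <= C & forall h, `|flat p h| <= C * h ^+ 2.
Proof.
(* The extra factor 'X^2, evaluated at the inverse of [h], is what supplies the bound in
   [h ^+ 2]. *)
have [C C0 HC] := poly_le_expR (p * 'X^2); exists C => // h; rewrite /flat.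
case: ifPn => h0; last by rewrite normr0 mulr_ge0 // sqr_ge0.
have := HC h^-1 (ltW _); rewrite invr_gt0 => /(_ h0).
rewrite hornerM hornerXn normrM normrX [`|h^-1|]gtr0_norm ?invr_gt0 //.
rewrite normrM [`|expR _|]gtr0_norm ?expR_gt0 // expRN exprVn.
rewrite ler_pdivrMr ?exprn_gt0 // => H.
by rewrite ler_pdivrMr ?expR_gt0 // mulrAC.
Qed.

Lemma is_derive_sqr_le (f : R -> R) C : 0 <= C ->
  (forall h, `|f h| <= C * h ^+ 2) -> is_derive (0 : R) (1 : R) f (0 : R).
Proof.
move=> C0 fC; have C1 : 0 < C + 1 by rewrite ltr_wpDl.
have f0 : f 0 = 0.
  by apply/eqP; rewrite -normr_le0 (le_trans (fC 0)) // expr0n mulr0.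
have H : (fun h => h^-1 *: ((f \o shift 0) (h *: 1) - f 0)) @ 0^' --> (0 : R).
  apply/cvgrPdist_le => e e0; near=> h.
  rewrite sub0r normrN /= f0 subr0 addr0 [h%:A]mulr1 normrM normfV.
  have h0 : h != 0 by near: h; exact: nbhs_dnbhs_neq.
  rewrite ler_pdivrMl ?normr_gt0 // (le_trans (fC h)) //.
  rewrite -[h ^+ 2]ger0_norm ?sqr_ge0 // normrX expr2 mulrCA ler_wpM2l //.
  have hd : `|h| <= e / (C + 1).
    near: h; by apply: dnbhs0_le; rewrite divr_gt0.
  rewrite (le_trans (ler_wpM2l C0 hd)) // mulrCA ger_pMr //.
  by rewrite ler_pdivrMr // mul1r lerDl.
by apply: DeriveDef; [apply/cvg_ex; exists 0|apply: cvg_lim H].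
Unshelve. all: by end_near. Qed.

Lemma is_derive_flat p t : is_derive t (1 : R) (flat p) (flat (flat_next p) t).
Proof.
have [t0|t0|<-] := ltgtP 0 t; last first.
- rewrite {2}/flat ltxx; have [C C0 HC] := flat_le_sqr p.
  exact: is_derive_sqr_le HC.
- rewrite {2}/flat (lt_gtF t0).
  apply: near_eq_is_derive (is_derive_cst (0 : R) t (1 : R)).
  near=> s; rewrite /flat; case: ifP => // s0.
  have : s < 0 by near: s; exact: lt_nbhsl.
  by rewrite ltNge (ltW s0).
- rewrite {2}/flat t0.
  have tn0 : t != 0 by rewrite gt_eqF.
  have dV : is_derive t (1 : R) (fun s : R => s^-1) (- t ^- 2).
    apply: DeriveDef; first exact: derivableV.
    by rewrite deriveV // derive_id [_ *: _]mulr1.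
  have dp : is_derive t^-1 (1 : R) (horner p) p^`().[t^-1].
    apply: DeriveDef; first exact: derivable_horner.
    by rewrite derivE derive1E.
  have d1 := @is_derive1_comp _ _ _ _ _ _ dp dV.
  have d2 := @is_derive1_comp _ expR (- (fun s : R => s^-1)) t _ _
    (is_derive_expR (- t^-1)) (is_deriveN dV).
  have := is_deriveM d1 d2; rewrite opprK /= => H.
  have {}H : is_derive t (1 : R) (fun s => p.[s^-1] * expR (- s^-1))
      ((flat_next p).[t^-1] * expR (- t^-1)).
    apply: is_derive_eq H _; rewrite /flat_next hornerM hornerXn hornerD hornerN.
    transitivity (p.[t^-1] * (expR (- t^-1) / t ^+ 2)
      + expR (- t^-1) * (p^`().[t^-1] * - t ^- 2)); first by [].
    rewrite exprVn.
    by move: (expR _) (p.[_]) (p^`().[_]) => u v w; field.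
  apply: near_eq_is_derive H.
  near=> s; rewrite /flat; have -> : 0 < s by near: s; exact: lt_nbhsr.
  by [].
Unshelve. all: by end_near. Qed.

End FlatFunctions.

(** * Extension of covectors to global 1-forms *)

Section BumpForms.
Variables (R : realType) (n : nat) (M : topologicalType).
Hypothesis hausM : hausdorff_space M.
Variable A : smooth_atlas R n M.
Local Notation idx := (chart_idx A).
Local Notation e_ i := (basis_vec R (i : 'I_n)).
Implicit Types (i j k : idx) (p q : M) (x y : 'rV[R]_n).

Definition overlap i j : set 'rV[R]_n := chart j @` (dom i `&` dom j).

Lemma cimage_chart j p : dom j p -> cimage j (chart j p).
Proof. by move=> jp; exists p. Qed.

Lemma param_dom j x : cimage j x -> dom j (param j x).
Proof. by case=> p jp <-; rewrite chartK. Qed.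

Lemma chart_param j x : cimage j x -> chart j (param j x) = x.
Proof. by case=> p jp <-; rewrite chartK. Qed.

Lemma cimage_open j : open (cimage (A := A) j).
Proof. exact: image_open. Qed.

Lemma param_preimage_open j (O : set M) :
  open O -> open (cimage j `&` param j @^-1` O).
Proof.
move=> oO; rewrite openE => x [jx Ox]; apply: filterI.
  by apply: open_nbhs_nbhs; split => //; exact: cimage_open.
have /(_ O) := param_cont jx; apply.
by apply: open_nbhs_nbhs.
Qed.

Lemma overlapE i j : overlap i j = cimage j `&` param j @^-1` dom i.
Proof.
apply/seteqP; split=> [x [p [ip jp] <-]|x [jx ix]].
  by split; [exact: cimage_chart|rewrite /= chartK].
by exists (param j x); [split => //; exact: param_dom|exact: chart_param].
Qed.

Lemma overlap_open i j : open (overlap i j).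
Proof. by rewrite overlapE; apply: param_preimage_open; exact: dom_open. Qed.

Lemma jacobian_cocycle i j k p : dom i p -> dom j p -> dom k p ->
  Defs.jacobian i k p = Defs.jacobian i j p *m Defs.jacobian j k p.
Proof.
move=> ip jp kp; apply/matrixP => a b; rewrite entM [LHS]mxE.
pose f y := chart i (param j y) 0 a.
pose phi y := chart j (param k y).
have kx : overlap j k (chart k p) by exists p.
have jx : overlap i j (phi (chart k p)) by rewrite /phi chartK //; exists p.
have dphi c : derivable (fun y => phi y 0 c) (chart k p) (e_ b).
  exact: smooth_on_derivable (transition_smooth j k c) kx.
have [_ E] := pd_comp (@overlap_open i j) (transition_smooth i j a) jx dphi.
transitivity (pd b (f \o phi) (chart k p)).
  apply: (pd_eq _ (@overlap_open j k) kx) => y; rewrite overlapE => -[ky jy].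
  by rewrite /f /phi /= chartK.
rewrite {}E; apply: eq_bigr => c _; rewrite /phi chartK //.
by rewrite [Defs.jacobian i j p a c]mxE [Defs.jacobian j k p c b]mxE.
Qed.

Lemma pd_coord (a b : 'I_n) x : pd b (fun y => y 0 a) x = (a == b)%:R.
Proof.
have -> : (a == b)%:R = 'D_(e_ b) id x 0 a :> R.
  by rewrite derive_id basis_vecE.
by rewrite derive_mx ?mxE //; exact: derivable_id.
Qed.

Lemma jacobian_id i p : dom i p -> Defs.jacobian i i p = 1%:M.
Proof.
move=> ip; apply/matrixP => a b; rewrite !mxE -(pd_coord a b (chart i p)).
apply: (pd_eq _ (@cimage_open i) (cimage_chart ip)) => y iy.
by rewrite chart_param.
Qed.

Section Bump.
Variables (c : 'rV[R]_n) (r : R).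

(** A product over coordinates fits the sup norm: the support lies in a closed cube around [c],
    which is compact. *)
Definition bump x : R :=
  \prod_a (flat 1 (r - (x 0 a - c 0 a)) * flat 1 (r + (x 0 a - c 0 a))).

Lemma bump_neq0 x : bump x != 0 -> forall a, `|x 0 a - c 0 a| <= r.
Proof.
move=> /prodf_neq0 H a; have := H a isT; rewrite mulf_eq0 negb_or => /andP[].
rewrite /flat ler_norml; case: ifPn => [h1 _|_]; last by rewrite eqxx.
by case: ifPn => [h2 _|_]; [move: h1 h2; lra|rewrite eqxx].
Qed.

Lemma bump_center : 0 < r -> bump c != 0.
Proof.
move=> r0; apply/prodf_neq0 => a _; rewrite subrr subr0 addr0 /flat r0.
by rewrite hornerC mul1r mulf_neq0 // gt_eqF // expR_gt0.
Qed.

Lemma smooth_bump_comp (U : set 'rV[R]_n) (theta : 'rV[R]_n -> 'rV[R]_n) :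
  open U -> (forall a, smooth_on U (fun y => theta y 0 a)) ->
  smooth_on U (fun y => bump (theta y)).
Proof.
move=> oU sth; apply: smooth_on_prod => // a.
pose D m := flat (iter m (@flat_next R) 1).
have dD (l : nat) (t : R) : [set: R] t -> is_derive t 1 (D l) (D l.+1 t).
  by move=> _; exact: is_derive_flat.
have sd : smooth_on U (fun y => theta y 0 a - c 0 a).
  by apply: smooth_onB => //; exact: smooth_on_cst.
apply: smooth_onM => //.
  apply: (smooth_on_comp1 0%N dD oU) => //.
  by apply: smooth_onB => //; exact: smooth_on_cst.
apply: (smooth_on_comp1 0%N dD oU) => //.
by apply: smooth_onD => //; exact: smooth_on_cst.
Qed.

End Bump.

(** * Extension by zero of a covector cut off by a bump function *)

Section ExtendForm.
Variables (i : idx) (p : M) (ip : dom i p) (t : 'rV[R]_n).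
Variable r : R.
Local Notation c := (chart i p).
Let B : set 'rV[R]_n := [set x | forall a, x 0 a \in `[c 0 a - r, c 0 a + r]].
Hypotheses (r0 : 0 < r) (Bi : B `<=` cimage i).

(** The image of a compact cube is compact, hence closed because the manifold is Hausdorff. Without
    this, extension by zero could fail to be smooth at points outside [dom i]. *)
Let supp_closed : closed (param i @` B).
Proof.
apply: compact_closed => //; apply: continuous_compact.
  apply: continuous_in_subspaceT => x; rewrite inE => /Bi.
  exact: param_cont.
apply: (@rV_compact _ _ (fun a => `[c 0 a - r, c 0 a + r]%classic)) => a.
exact: segment_compact.
Qed.

Definition extended_form j x : 'rV[R]_n :=
  if `[< dom i (param j x) >] then
    (bump c r (chart i (param j x)) / bump c r c)
      *: (t *m Defs.jacobian i j (param j x))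
  else 0.

Lemma extended_form_smooth j (a : 'I_n) :
  smooth_on (cimage j) (fun x => extended_form j x 0 a).
Proof.
apply: smooth_on_local => x jx; have [ix|ix] := pselect (dom i (param j x)).
- exists (overlap i j); split; first by rewrite overlapE.
  have oV := @overlap_open i j.
  have : smooth_on (overlap i j) (fun y =>
      bump c r (chart i (param j y)) / bump c r c *
      \sum_b t 0 b * pd a (fun z => chart i (param j z) 0 b) y).
    apply: smooth_onM => //.
      apply: smooth_onM => //; last exact: smooth_on_cst.
      by apply: smooth_bump_comp => // b; exact: transition_smooth.
    apply: smooth_on_sum => // b; apply: smooth_onM => //.
      exact: smooth_on_cst.
    exact/smooth_on_pd/transition_smooth.
  apply: smooth_on_eq => // y; rewrite overlapE => -[jy iy].
  rewrite /extended_form asboolT // entZ entM; congr (_ * _).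
  by apply: eq_bigr => b _; rewrite mxE chart_param.
(* The complement of the closed support is an open neighbourhood of such a point. It may still meet
   [dom i], but the bump vanishes there. *)
- pose V := cimage j `&` param j @^-1` (~` (param i @` B)).
  have oV : open V by apply: param_preimage_open; exact: closed_openC.
  exists V; split.
    by split => // -[y /Bi /param_dom iy E]; apply: ix; rewrite -E.
  apply: (smooth_on_eq oV _ (smooth_on_cst V 0)) => y [jy By].
  rewrite /extended_form; case: asboolP => [iy|_]; last by rewrite mxE.
  have [->|/bump_neq0 H] := eqVneq (bump c r (chart i (param j y))) 0.
    by rewrite mul0r scale0r mxE.
  case: By; exists (chart i (param j y)); last exact: chartK.
  move=> a'; have := H a'; rewrite ler_norml in_itv /=.
  by move=> /andP[h1 h2]; apply/andP; split; move: h1 h2; lra.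
Qed.

Lemma extended_form_one_form : one_form extended_form.
Proof.
split=> [j a|j k q jq kq]; first exact: extended_form_smooth.
rewrite /extended_form !chartK //; case: asboolP => iq; last by rewrite mul0mx.
by rewrite (jacobian_cocycle iq jq kq) mulmxA scalemxAl.
Qed.

Lemma extended_form_value : extended_form i c = t.
Proof.
rewrite /extended_form chartK // asboolT // divff ?bump_center //.
by rewrite scale1r jacobian_id // mulmx1.
Qed.

End ExtendForm.

Lemma one_form_extension i p (t : 'rV[R]_n) : dom i p ->
  exists2 T, one_form (A := A) T & T i (chart i p) = t.
Proof.
move=> ip.
have /nbhs_ballP[e /= e0 eU] : nbhs (chart i p) (cimage i).
  by apply: open_nbhs_nbhs; split; [exact: cimage_open|exact: cimage_chart].
(* Half the radius, so that the closed cube fits in the open ball inside the chart. *)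
have r0 : 0 < e / 2 by rewrite divr_gt0.
have BU : [set x : 'rV[R]_n | forall a, x 0 a \in
    `[chart i p 0 a - e / 2, chart i p 0 a + e / 2]] `<=` cimage i.
  move=> x Bx; apply: eU; rewrite -ball_normE /=.
  apply: (@le_lt_trans _ _ (e / 2)); last by rewrite ltr_pdivrMr // ltr_pMr // ltr1n.
  apply: norm_rV_le => [|a]; first exact: ltW.
  have := Bx a; rewrite in_itv /= !mxE ler_norml => /andP[h1 h2].
  by apply/andP; split; move: h1 h2; lra.
exists (extended_form i p t (e / 2)).
  exact: extended_form_one_form.
exact: extended_form_value.
Qed.

End BumpForms.

(** * Venzi spaces *)

Section MainProof.
Variables (R : realType) (n : nat) (M : topologicalType).
Hypothesis n3 : (3 <= n)%N.
Variables (A : smooth_atlas R n M) (g : riemannian_metric A).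
Local Notation idx := (chart_idx A).
Local Notation e_ i := (basis_vec R (i : 'I_n)).
Implicit Types (i j : idx) (p q : M) (x y : 'rV[R]_n).

Local Notation Gi i := (gmx g i).
Let oC i : open (cimage i) := @cimage_open _ _ _ A i.
Let sG i : smooth_mx (cimage i) (Gi i) := @gmx_smooth _ _ _ _ g i.
Let Gsym i : forall x, cimage i x -> (Gi i x)^T = Gi i x := @gmx_sym _ _ _ _ g i.
Let Gpos i : forall x, cimage i x -> forall u : 'rV[R]_n, u != 0 ->
  0 < (u *m Gi i x *m u^T) 0 0 := @gmx_pos _ _ _ _ g i.

Definition const_curv_at i x (c : R) : Prop := forall X Y Z W : 'rV[R]_n,
  riem (Gi i) x X Y Z W =
  c * (ip (Gi i x) Y Z * ip (Gi i x) X W - ip (Gi i x) X Z * ip (Gi i x) Y W).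

Lemma sectional_const i x c : cimage i x -> const_curv_at i x c ->
  forall u v : 'rV[R]_n, free [:: u; v] -> sectional (Gi i) x u v = c.
Proof.
move=> ix Hc u v uv; have := gram_gt0 (Gsym ix) (Gpos ix) uv.
rewrite /sectional /inner -!/(ip _ _ _) Hc (ipC (Gsym ix) v u) => /lt0r_neq0 h.
by rewrite -expr2 (mulrC (ip _ v v)) mulfK.
Qed.

Lemma free_basis01 : exists u v : 'rV[R]_n, free [:: u; v].
Proof.
have h0 : (0 < n)%N by exact: leq_trans n3.
have h1 : (1 < n)%N by exact: leq_trans n3.
exists (e_ (Ordinal h0)), (e_ (Ordinal h1)).
rewrite free_cons seq1_free span_seq1; apply/andP; split.
  apply/vlineP => -[k] /rowP /(_ (Ordinal h0)).
  by rewrite entZ !basis_vecE eqxx mulr0 => /eqP; rewrite oner_eq0.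
by apply/eqP => /rowP /(_ (Ordinal h1)) /eqP; rewrite basis_vecE eqxx mxE oner_eq0.
Qed.

(** Evaluated on one free pair, [riem_pullback] equates [c] and [d] times the same positive Gram
    determinant. *)
Lemma const_curv_overlap i j p c d : dom i p -> dom j p ->
  const_curv_at i (chart i p) c -> const_curv_at j (chart j p) d -> c = d.
Proof.
move=> ip_ jp Hc Hd.
have jx := cimage_chart jp; have ix := cimage_chart ip_.
have oV := @overlap_open _ _ _ A i j.
have Vx : overlap i j (chart j p) by exists p.
have Vj y : overlap i j y -> cimage j y by rewrite overlapE => -[].
pose phi y := chart i (param j y).
have phiU y : overlap i j y -> cimage i (phi y).
  by rewrite overlapE => -[_ iy]; exact: cimage_chart.
have GE y : overlap i j y -> Gi j y =
    (jac_mx phi y)^T *m Gi i (phi y) *m jac_mx phi y.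
  rewrite overlapE => -[jy iy].
  have := gmx_compat g iy (param_dom jy).
  rewrite chart_param // => ->.
  suff -> : Defs.jacobian i j (param j y) = jac_mx phi y by [].
  by apply/matrixP => a b; rewrite [LHS]mxE jacE chart_param.
have sGj : smooth_mx (overlap i j) (Gi j).
  by move=> a b; apply: smooth_on_sub (@sG j a b).
have sym' y : overlap i j y -> (Gi j y)^T = Gi j y by move=> /Vj; exact: Gsym.
have pos' y : overlap i j y -> forall u : 'rV[R]_n, u != 0 ->
  0 < (u *m Gi j y *m u^T) 0 0 by move=> /Vj; exact: Gpos.
have sphi a : smooth_on (overlap i j) (fun y => phi y 0 a).
  exact: transition_smooth.
have [u [v uv]] := free_basis01.
have gr := gram_gt0 (sym' _ Vx) (pos' _ Vx) uv.
have := riem_pullback (@oC i) (@sG i) (@Gsym i) (@Gpos i) oV sGj pos'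
  sphi phiU GE u v v u Vx.
have phip : phi (chart j p) = chart i p by rewrite /phi chartK.
rewrite Hd phip Hc -phip -!(ip_pullback GE _ _ Vx) (ipC (sym' _ Vx) v u) -expr2.
rewrite (mulrC (ip _ v v)) => /esym; apply: mulIf.
by rewrite gt_eqF.
Qed.

Lemma const_curv_globalize (K : idx -> 'rV[R]_n -> R) :
  connected [set: M] ->
  (forall i x, cimage i x -> const_curv_at i x (K i x)) ->
  constant_curvature g.
Proof.
move=> connM HK.
have KK i j p : dom i p -> dom j p -> K i (chart i p) = K j (chart j p).
  move=> ip_ jp; apply: (const_curv_overlap ip_ jp); apply: HK;
    exact: cimage_chart.
(* One chart is chosen at each point to define a function on the manifold; by [KK] the choice is
   immaterial. *)
have [ch Hch] := choice (@dom_cover _ _ _ A).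
pose kap p := K (ch p) (chart (ch p) p).
have kapE i p : dom i p -> kap p = K i (chart i p) by move=> ip_; exact: KK.
have loc p : \forall q \near p, kap q = kap p.
  pose i := ch p; have ip_ : dom i p by exact: Hch.
  have ix := cimage_chart ip_.
  have sK := smooth_const_curv (@oC i) (@sG i) (@Gsym i) (@Gpos i) n3 (HK i).
  have pdK x a : cimage i x -> pd a (K i) x = 0.
    exact: (schur_pd (@oC i) (@sG i) (@Gsym i) (@Gpos i) n3 (HK i)).
  have /nbhs_ballP[r /= r0 rU] : nbhs (chart i p) (cimage i).
    by apply: open_nbhs_nbhs; split.
  have Kc y : `|y - chart i p| < r -> K i y = K i (chart i p).
    apply: pd0_const_ball => z zr a.
    have iz : cimage i z by apply: rU; rewrite -ball_normE /= distrC.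
    by split; [exact: smooth_on_derivable sK iz|exact: pdK].
  have ni : nbhs p (dom i).
    by apply: open_nbhs_nbhs; split => //; exact: dom_open.
  have nb : nbhs p (chart i @^-1` ball (chart i p) r).
    by apply: (chart_cont ip_); exact: nbhsx_ballx.
  apply: filterS (filterI ni nb) => q [iq]; rewrite /= -ball_normE /= => qr.
  by rewrite (kapE i) // (kapE i p) //; apply: Kc; rewrite distrC.
(* The empty space counts as connected; any constant works for it. *)
have [[p0 _]|M0] := pselect (exists p : M, True); last first.
  by exists 0 => i p; case: M0; exists p.
(* By [loc] both the level set and its complement are open. *)
have all_eq : [set q | kap q = kap p0] = [set: M].
  apply: connM; first by exists p0.
  - exists [set q | kap q = kap p0]; last by rewrite setTI.
    rewrite openE => q /= <-; exact: loc.
  - exists [set q | kap q = kap p0]; last by rewrite setTI.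
    rewrite -openC openE => q /= qp; apply: filterS (loc q) => z /= ->.
    exact: qp.
exists (kap p0) => i p ip_ u v uv.
have -> : kap p0 = K i (chart i p).
  by rewrite -(kapE i) //; have : [set: M] p by []; rewrite -all_eq => ->.
apply: sectional_const uv; [exact: cimage_chart|].
by apply: HK; exact: cimage_chart.
Qed.

Lemma pairing_ip i x t u : cimage i x ->
  pairing t u = ip (Gi i x) u (t *m invmx (Gi i x)).
Proof.
move=> ix; have uG := posdef_unit (Gpos ix).
rewrite /ip trmx_mul trmx_inv (Gsym ix) mulmxA mulmxK // entM.
by apply: eq_bigr => a _; rewrite entT mulrC.
Qed.

(** Only the value of a global form at one point matters: [vpick U] is a nonzero such value because
    the dimension is positive, and [pairing_ip] turns it into the vector [T] of
    [venzi_curvature]. *)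
Lemma venzi_const_curv : venzi_space (projective_tensor g) ->
  forall i x, cimage i x -> exists c, const_curv_at i x c.
Proof.
move=> Hv i x ix; have [p ip_ px] := ix.
have [U [HU dU]] := Hv i p ip_.
have [T [_ VT] Tp] : exists2 T, venzi_forms (projective_tensor g) T &
    T i (chart i p) = vpick U by apply/(HU _).1; exact: memv_pick.
have t0 : vpick U != 0 by rewrite vpick0 -dimv_eq0 -lt0n.
have uG := posdef_unit (Gpos ix).
have T0 : vpick U *m invmx (Gi i x) != 0.
  by apply: contra t0 => /eqP h; rewrite -[vpick U](mulmxKV uG) h mul0mx.
apply: (venzi_curvature (Gsym ix) (Gpos ix) n3 _ T0).
  exact: (riem_curvature_like (@oC i) (@sG i) (@Gsym i) (@Gpos i) ix).
move=> X1 X2 X3 X4 X5; have := VT i x ix X1 X2 X3 X4 X5.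
by rewrite -px Tp px !(pairing_ip _ _ ix).
Qed.

Lemma const_curv_venzi : hausdorff_space M -> constant_curvature g ->
  venzi_space (projective_tensor g).
Proof.
move=> hausM [c Hc].
have P0 i x X1 X2 X3 X4 : cimage i x -> projective_tensor g i x X1 X2 X3 X4 = 0.
  move=> ix; have [p ip_ px] := ix.
  have cR := riem_curvature_like (@oC i) (@sG i) (@Gsym i) (@Gpos i) ix.
  have E := sectional_const_curv (Gsym ix) (Gpos ix) cR.
  apply: (proj_part_const (Gsym ix) (Gpos ix) (leq_trans _ n3) (E c _)) => //.
  by move=> u v uv; have := Hc i p ip_ u v uv; rewrite px.
(* With [P] zero every 1-form qualifies, so the values at a point fill the whole space of
   covectors. *)
move=> i p ip_; exists fullv; split; last first.
  by rewrite dimvf /dim /= mul1n (leq_trans _ n3).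
move=> t; split=> [_|_]; last exact: memvf.
have [T oneT Tt] := one_form_extension hausM t ip_.
exists T => //; split=> // j x jx X1 X2 X3 X4 X5.
by rewrite !P0 // !mulr0 !addr0.
Qed.

End MainProof.

Theorem corollary4p1 (R : realType) (n : nat) (hn : (3 <= n)%N)
  (M : topologicalType) (hausM : hausdorff_space M)
  (sndM : @second_countable M) (connM : connected [set: M]%classic)
  (A : smooth_atlas R n M) (g : riemannian_metric A) :
  venzi_space (projective_tensor g) <-> constant_curvature g.
Proof.
split=> [Hv|]; last exact: const_curv_venzi.
(* [choice] needs a constant for every pair of a chart and coordinates; outside the image of the
   chart the value 0 is a dummy. *)
have H (ix : chart_idx A * 'rV[R]_n) : exists c,
    cimage ix.1 ix.2 -> const_curv_at g ix.1 ix.2 c.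
  have [h|h] := pselect (cimage ix.1 ix.2); last by exists 0.
  by have [c hc] := venzi_const_curv hn Hv h; exists c.
have [K HK] := choice H.
apply: (const_curv_globalize hn (K := fun i x => K (i, x)) connM) => i x ix.
exact: (HK (i, x)).
Qed.
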